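(* Let $\mathbb K$ be a discrete field and let $(V,\phi)$ be a topological flow over $\mathbb K$. Then there is a topological isomorphism of flows $$(P_{top}(V,\phi),\overline\phi^t)\cong_{top}(V/P_{alg}(\widehat V,\widehat\phi)^\perp,\overline\phi^a),$$ where $\overline\phi^t\colon P_{top}(V,\phi)\to P_{top}(V,\phi)$ and $\overline\phi^a\colon V/P_{alg}(\widehat V,\widehat\phi)^\perp\to V/P_{alg}(\widehat V,\widehat\phi)^\perp$ are both induced by $\phi$. In particular, $D_+(V,\phi)\cong_{top}P_{alg}(\widehat V,\widehat\phi)^\perp$ (topological isomorphism) and $\widehat{D_+(V,\phi)}\cong F_+(\widehat V,\widehat\phi)$. Moreover, $(V,\phi)$ has completely positive topological entropy if and only if $(\widehat V,\widehat\phi)$ has completely positive algebraic entropy.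
   Context: A Hausdorff topological $\mathbb K$-space is linearly topologized if it has a neighbourhood basis at $0$ consisting of $\mathbb K$-subspaces; it is linearly compact if moreover any collection of closed linear varieties with the finite intersection property has non-empty intersection. A topological flow is a pair $(V,\phi)$ with $V$ a linearly compact $\mathbb K$-space and $\phi$ a continuous linear endomorphism; an algebraic flow is a pair $(W,\psi)$ with $W$ a discrete $\mathbb K$-space and $\psi$ a linear endomorphism. A subspace $Z$ is invariant if it is mapped into itself by the endomorphism; isomorphisms of flows commute with the endomorphisms. Entropies. For $V$ linearly compact, $\mathrm{ent}^*(V,\phi)=\sup_U\lim_{n\to\infty}\frac1n\dim_{\mathbb K}\big(U/(U\cap\phi^{-1}U\cap\cdots\cap\phi^{-n+1}U)\big)$, with $U$ ranging over the linearly compact open subspaces of $V$. For $W$ discrete, $\mathrm{ent}(W,\psi)=\sup_U\lim_{n\to\infty}\frac1n\dim_{\mathbb K}\big((U+\psi U+\cdots+\psi^{n-1}U)/U\big)$, with $U$ ranging over the finite-dimensional subspaces of $W$. A topological flow $(V,\phi)$ has completely positive topological entropy if $\mathrm{ent}^*(V/Z,\overline\phi)\neq0$ for every proper closed $\phi$-invariant subspace $Z$ of $V$, $\overline\phi$ being induced by $\phi$. $D_+(V,\phi)$ (the domain of completely positive topological entropy) is the largest closed $\phi$-invariant subspace of $V$ such that $(D_+(V,\phi),\phi\restriction_{D_+(V,\phi)})$ has completely positive topological entropy; equivalently, $D_+(V,\phi)$ is the intersection of all closed $\phi$-invariant subspaces $Z$ with $\mathrm{ent}^*(V/Z,\overline\phi)=0$.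 $P_{top}(V,\phi)=V/D_+(V,\phi)$ (the Pinsker factor). An algebraic flow $(W,\psi)$ has completely positive algebraic entropy if $\mathrm{ent}(Z,\psi\restriction_Z)\neq0$ for every non-zero $\psi$-invariant subspace $Z$ of $W$. $P_{alg}(W,\psi)$ (the Pinsker subspace) is the largest $\psi$-invariant subspace of $W$ on which $\psi$ has zero algebraic entropy, and $F_+(W,\psi)=W/P_{alg}(W,\psi)$. Lefschetz duality. For $V$ linearly compact, $\widehat V$ is the space of continuous linear maps $V\to\mathbb K$, which is discrete, and $\widehat\phi(\chi)=\chi\circ\phi$. Via the canonical topological isomorphism of $V$ with its double dual, for a subspace $P\le\widehat V$ one regards $P^\perp=\{v\in V\mid\chi(v)=0\ \forall\chi\in P\}$ as a closed subspace of $V$. *)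

(* Defs.v *)
From HB Require Import structures.
From mathcomp Require Import all_boot all_order all_algebra.
From mathcomp Require Import generic_quotient ring_quotient.
From mathcomp Require Import all_classical all_reals.
From mathcomp Require Import topology ereal.

Set Implicit Arguments.
Unset Strict Implicit.
Unset Printing Implicit Defensive.

Import GRing.Theory.

Local Open Scope classical_set_scope.
Local Open Scope ring_scope.

(* The analogous structure of mathcomp.analysis.tvs asks for a numDomainType of
   scalars, and HB refuses a second structure with the same mixins: this file
   must not load tvs. No compatibility between the topology and the operations
   is required here; see topological_vector_space. *)
#[short(type="topLmodType")]
HB.structure Definition TopLmod (K : fieldType) :=
  {V of Topological V & GRing.Lmodule K V}.

Section Subspaces.
Variables (K : fieldType) (V : lmodType K).
Implicit Type U : submodClosed V.

Definition sub_space U : Type := {x : V | x \in U}.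

HB.instance Definition _ U := SubChoice.on (sub_space U).
HB.instance Definition _ U := [SubChoice_isSubLmodule of sub_space U by <:].

(* submodClosed does not inherit from zmodClosed, which Quotient.quot needs. *)
Definition zmod_of U : {pred V} := fun x => x \in U.

Fact zmod_of_closed U : zmod_closed (zmod_of U).
Proof.
split=> [|x y xU yU]; first by change (0 \in U); exact: rpred0.
change (x - y \in U); rewrite rpredD// -scaleN1r.
exact: rpredZ.
Qed.

HB.instance Definition _ U :=
  GRing.isZmodClosed.Build V (zmod_of U) (zmod_of_closed U).

Definition quot_space U : Type := Quotient.quot (zmod_of U).

HB.instance Definition _ U := GRing.Zmodule.on (quot_space U).
HB.instance Definition _ U := EqQuotient.on (quot_space U).

Definition quot_pi U (x : V) : quot_space U := (\pi_(quot_space U) x)%qT.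

Lemma quot_piP U x y : (quot_pi U x = quot_pi U y) <-> x - y \in U.
Proof.
change (quot_pi U x = quot_pi U y <-> x - y \in zmod_of U).
by rewrite Quotient.idealrBE; split => [E|/eqP//]; apply/eqP; exact: E.
Qed.

Lemma quot_pi_repr U (q : quot_space U) : quot_pi U (repr q) = q.
Proof. exact: reprK. Qed.

Lemma quot_piD U x y : quot_pi U (x + y) = quot_pi U x + quot_pi U y.
Proof. by rewrite /quot_pi !piE. Qed.

Definition quot_scale U (a : K) (q : quot_space U) : quot_space U :=
  quot_pi U (a *: repr q).

Lemma quot_piZ U a x : quot_pi U (a *: x) = quot_scale a (quot_pi U x).
Proof.
apply/quot_piP; rewrite -scalerBr rpredZ//.
by apply/quot_piP; rewrite quot_pi_repr.
Qed.

Section QuotientLmodule.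
Variable U : submodClosed V.
Implicit Types (a b : K) (q : quot_space U).

Fact quot_scaleA a b q : quot_scale a (quot_scale b q) = quot_scale (a * b) q.
Proof. by rewrite -[q]quot_pi_repr -!quot_piZ scalerA. Qed.

Fact quot_scale1 q : quot_scale 1 q = q.
Proof. by rewrite -[q]quot_pi_repr -quot_piZ scale1r. Qed.

Fact quot_scaleDr a : {morph @quot_scale U a : q1 q2 / q1 + q2}.
Proof.
move=> q1 q2; rewrite -[q1]quot_pi_repr -[q2]quot_pi_repr.
by rewrite -quot_piD -!quot_piZ scalerDr quot_piD.
Qed.

Fact quot_scaleDl q : {morph (@quot_scale U)^~ q : a b / a + b}.
Proof.
by move=> a b; rewrite -[q]quot_pi_repr -!quot_piZ scalerDl quot_piD.
Qed.

HB.instance Definition _ := GRing.Zmodule_isLmodule.Build K (quot_space U)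
  quot_scaleA quot_scale1 quot_scaleDr quot_scaleDl.

Fact quot_pi_is_linear : linear (quot_pi U).
Proof. by move=> a x y; rewrite quot_piD quot_piZ. Qed.

HB.instance Definition _ :=
  GRing.isLinear.Build K V (quot_space U) *:%R (quot_pi U) quot_pi_is_linear.

End QuotientLmodule.

Section Invariant.
Variable phi : {linear V -> V}.

Definition invariant_sub U : Prop := forall x, x \in U -> phi x \in U.

Section RestrInduced.
Variable U : submodClosed V.

Definition restr_map (phiU : invariant_sub U) (x : sub_space U) : sub_space U :=
  exist _ (phi (val x)) (phiU _ (valP x)).

Fact restr_is_linear phiU : linear (restr_map phiU).
Proof. by move=> a x y; apply/val_inj; rewrite /= linearP. Qed.

HB.instance Definition _ phiU :=
  GRing.isLinear.Build K (sub_space U) (sub_space U) *:%R (restr_map phiU)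
    (restr_is_linear phiU).

(* phiU is used only in the linearity proof, but must be an argument for the
   linear structure to be inferred. *)
Definition induced_map (phiU : invariant_sub U) (q : quot_space U) : quot_space U :=
  quot_pi U (phi (repr q)).

Lemma induced_pi phiU x : induced_map phiU (quot_pi U x) = quot_pi U (phi x).
Proof.
apply/quot_piP; rewrite -linearB; apply: (phiU).
by apply/quot_piP; rewrite quot_pi_repr.
Qed.

Fact induced_is_linear phiU : linear (induced_map phiU).
Proof.
move=> a q1 q2; rewrite -[q1]quot_pi_repr -[q2]quot_pi_repr.
by rewrite -linearP !induced_pi -linearP -linearP.
Qed.

HB.instance Definition _ phiU :=
  GRing.isLinear.Build K (quot_space U) (quot_space U) *:%R (induced_map phiU)
    (induced_is_linear phiU).

End RestrInduced.

End Invariant.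

End Subspaces.
Arguments restr_map {K V phi U} phiU x.
Arguments induced_map {K V phi U} phiU q.

Section Topology.
Variables (K : fieldType) (V : topLmodType K).
Implicit Type U : submodClosed V.

HB.instance Definition _ U := Topological.copy (sub_space U)
  (initial_topology (val : sub_space U -> V)).

Section QuotientTopology.
Variable U : submodClosed V.

Definition quot_open (A : set (quot_space U)) : Prop := open (quot_pi U @^-1` A).

Fact quot_openT : quot_open setT.
Proof. by rewrite /quot_open preimage_setT; exact: openT. Qed.

Fact quot_openI : setI_closed quot_open.
Proof. by move=> A B oA oB; rewrite /quot_open preimage_setI; exact: openI. Qed.

Fact quot_open_bigU (I : Type) (A : I -> set (quot_space U)) :
  (forall i, quot_open (A i)) -> quot_open (\bigcup_i A i).
Proof.
move=> oA; rewrite /quot_open preimage_bigcup; apply: bigcup_open => i _; exact: oA.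
Qed.

HB.instance Definition _ := isOpenTopological.Build (quot_space U)
  quot_openT quot_openI quot_open_bigU.

End QuotientTopology.

(* K carries the discrete topology. *)
Definition topological_vector_space : Prop :=
  continuous (fun x : V * V => x.1 + x.2) /\
  continuous (fun x : discrete_topology K * V => (x.1 : K) *: x.2).

Definition linearly_topologized : Prop :=
  [/\ topological_vector_space, hausdorff_space V &
      forall A : set V, nbhs 0 A ->
        exists U, nbhs 0 [set` U] /\ [set` U] `<=` A].

Definition linear_variety (A : set V) : Prop :=
  exists (v : V) (U : submodClosed V), A = [set v + u | u in [set` U]].

Definition linearly_compact : Prop :=
  linearly_topologized /\
  forall F : set (set V),
    (forall A, F A -> closed A /\ linear_variety A) -> finI F id ->
    \bigcap_(A in F) A !=set0.

End Topology.
Arguments linearly_compact {K} V.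

Section Dimension.
Variables (R : realType) (K : fieldType).

Definition is_basis (W : lmodType K) n (b : 'I_n -> W) : Prop :=
  bijective (fun c : 'rV[K]_n => \sum_(i < n) c 0 i *: b i).

Definition finite_dimensional (W : lmodType K) : Prop :=
  exists n (b : 'I_n -> W), is_basis b.

(* The size of any finite basis of W, and ereal_inf set0 = +oo without one. *)
Definition dimension (W : lmodType K) : \bar R :=
  ereal_inf [set (n%:R)%:E | n in [set n | exists b : 'I_n -> W, is_basis b]].

Variable V : lmodType K.
Implicit Types A B : submodClosed V.

Definition trace_sub A B : {pred sub_space A} := fun x => val x \in B.
Arguments trace_sub A B x : clear implicits.

Fact trace_sub_closed A B : subsemimod_closed (trace_sub A B).
Proof.
split; first split=> [|x y xB yB].
- by change (0 \in B); exact: rpred0.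
- by change (val x + val y \in B); exact: rpredD.
- by move=> a x xB; change (a *: val x \in B); exact: rpredZ.
Qed.

HB.instance Definition _ A B :=
  GRing.isSubmodClosed.Build K (sub_space A) (trace_sub A B)
    (trace_sub_closed A B).

(* dimension of A / (A :&: B), hence of A / B when B is contained in A *)
Definition dim_quot A B : \bar R := dimension (quot_space (trace_sub A B)).

End Dimension.

Section Entropy.
Variables (R : realType) (K : fieldType).

Section Trajectories.
Variables (V : lmodType K) (phi : {linear V -> V}).
Implicit Type U : submodClosed V.

Lemma iter_linear n : linear (iter n phi).
Proof. by elim: n => [//|n IH] a x y; rewrite !iterS IH linearP. Qed.

(* For n > 0 the intersection of the phi^-i(U), i < n (it lies in U); for n = 0
   everything, which does not affect limits. *)
Definition cotraj U n : {pred V} := fun x => [forall i : 'I_n, iter i phi x \in U].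

Fact cotraj_closed U n : subsemimod_closed (cotraj U n).
Proof.
split; first split=> [|x y /forallP xU /forallP yU].
- apply/forallP => i; suff -> : iter i phi 0 = 0 by exact: rpred0.
  by elim: (i : nat) => //= m ->; rewrite linear0.
- apply/forallP => i; rewrite -[x]scale1r iter_linear scale1r.
  by rewrite rpredD ?xU ?yU.
- move=> a x /forallP xU; apply/forallP => i; rewrite -[a *: x]addr0 iter_linear.
  rewrite rpredD ?rpredZ ?xU//; suff -> : iter i phi 0 = 0 by exact: rpred0.
  by elim: (i : nat) => //= m ->; rewrite linear0.
Qed.

HB.instance Definition _ U n :=
  GRing.isSubmodClosed.Build K V (cotraj U n) (cotraj_closed U n).

(* the sum of the phi^i(U), i < n *)
Definition traj U n : {pred V} := fun y =>
  `[< exists u : 'I_n -> V,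
        (forall i, u i \in U) /\ y = \sum_(i < n) iter i phi (u i) >].

Fact traj_closed U n : subsemimod_closed (traj U n).
Proof.
have iter0 m : iter m phi 0 = 0 by elim: m => //= m ->; rewrite linear0.
split; first split=> [|x y /asboolP[u [uU ->]] /asboolP[v [vU ->]]].
- apply/asboolP; exists (fun=> 0); split=> [i|]; first exact: rpred0.
  by rewrite big1.
- apply/asboolP; exists (fun i => u i + v i); split=> [i|].
    by rewrite rpredD.
  rewrite -big_split/=; apply: eq_bigr => i _.
  by rewrite -[u i in RHS]scale1r -{1}[u i]scale1r iter_linear !scale1r.
- move=> a x /asboolP[u [uU ->]]; apply/asboolP; exists (fun i => a *: u i).
  split=> [i|]; first by rewrite rpredZ.
  rewrite scaler_sumr; apply: eq_bigr => i _.
  by rewrite -[a *: u i]addr0 iter_linear iter0 addr0.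
Qed.

HB.instance Definition _ U n :=
  GRing.isSubmodClosed.Build K V (traj U n) (traj_closed U n).

End Trajectories.

Local Open Scope ereal_scope.

Definition ent_top (V : topLmodType K) (phi : {linear V -> V}) : \bar R :=
  ereal_sup [set lim ((fun n => (n%:R^-1)%:E * dim_quot R U (cotraj phi U n))
                        @ \oo)
            | U in [set U : submodClosed V |
                     open [set` U] /\ linearly_compact (sub_space U)]].

Definition ent_alg (W : lmodType K) (psi : {linear W -> W}) : \bar R :=
  ereal_sup [set lim ((fun n => (n%:R^-1)%:E * dim_quot R (traj psi U n) U)
                        @ \oo)
            | U in [set U : submodClosed W | finite_dimensional (sub_space U)]].

Definition cp_ent_top (V : topLmodType K) (phi : {linear V -> V}) : Prop :=
  forall (Z : submodClosed V) (phiZ : invariant_sub phi Z),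
    closed [set` Z] -> (exists x, x \notin Z) -> ent_top (induced_map phiZ) != 0.

Definition cp_ent_alg (W : lmodType K) (psi : {linear W -> W}) : Prop :=
  forall (Z : submodClosed W) (psiZ : invariant_sub psi Z),
    (exists2 x, x \in Z & (x != 0)%R) -> ent_alg (restr_map psiZ) != 0.

End Entropy.

Section Largest.
Variables (K : fieldType) (V : lmodType K).

Definition zero_sub : {pred V} := pred1 0.

Fact zero_sub_closed : subsemimod_closed zero_sub.
Proof.
split; first split=> [|x y /eqP-> /eqP->]; rewrite ?addr0 ?inE//.
by move=> a x /eqP->; rewrite scaler0 inE.
Qed.

HB.instance Definition _ :=
  GRing.isSubmodClosed.Build K V zero_sub zero_sub_closed.

Definition is_largest (P : submodClosed V -> Prop) (D : submodClosed V) : Prop :=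
  P D /\ forall Z, P Z -> {subset Z <= D}.

(* zero_sub is a junk value for the case where no largest subspace exists *)
Definition largest (P : submodClosed V -> Prop) : submodClosed V :=
  xget (zero_sub : {classic submodClosed V}) (is_largest P).

Lemma largest_invariant (phi : {linear V -> V}) P :
  (forall Z, P Z -> invariant_sub phi Z) -> invariant_sub phi (largest P).
Proof.
move=> Pinv; rewrite /largest; case: xgetP => [D _ [PD _]|_]; first exact: Pinv.
by move=> x /eqP->; rewrite linear0 inE.
Qed.

End Largest.

Section Pinsker.
Variables (R : realType) (K : fieldType).

Section Topological.
Variables (V : topLmodType K) (phi : {linear V -> V}).

Definition Dplus : submodClosed V := largest (fun Z =>
  closed [set` Z] /\ exists phiZ : invariant_sub phi Z, cp_ent_top R (restr_map phiZ)).

Lemma Dplus_invariant : invariant_sub phi Dplus.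
Proof. by apply: largest_invariant => Z [_ []]. Qed.

Definition Ptop : topLmodType K := quot_space Dplus.

Definition Ptop_map : {linear Ptop -> Ptop} := induced_map Dplus_invariant.

End Topological.

Section Algebraic.
Variables (W : lmodType K) (psi : {linear W -> W}).

Definition Palg : submodClosed W := largest (fun Z =>
  exists psiZ : invariant_sub psi Z, ent_alg R (restr_map psiZ) = 0%E).

Lemma Palg_invariant : invariant_sub psi Palg.
Proof. by apply: largest_invariant => Z []. Qed.

Definition Fplus : lmodType K := quot_space Palg.

End Algebraic.

End Pinsker.
Arguments Palg_invariant R {K W} psi.
Arguments Dplus_invariant R {K V} phi.

Section Duality.
Variables (K : fieldType) (V : topLmodType K).

(* K^o is K as a K-module, discrete_topology K is K as a topological space. *)
Definition cont_dual_pred : {pred V -> K^o} := fun f =>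
  `[< linear f /\ continuous (f : V -> discrete_topology K) >].

Lemma continuous_discreteP (f : V -> K) :
  continuous (f : V -> discrete_topology K) <->
  forall x, \forall y \near x, f y = f x.
Proof.
split=> fc x; first by apply: (fc x [set f x]); exact/principal_filterP.
move=> A /principal_filterP Afx; rewrite /= nbhs_simpl.
by apply: filterS (fc x) => y /= ->.
Qed.

Fact dual_pred_closed : subsemimod_closed cont_dual_pred.
Proof.
split; first split=> [|f g /asboolP[fl fc] /asboolP[gl gc]].
- apply/asboolP; split=> [a x y|]; first by rewrite /= scaler0 addr0.
  by apply/continuous_discreteP => x; apply: nearW.
- apply/asboolP; split=> [a x y|].
    by rewrite /GRing.add/= fl gl scalerDr addrACA.
  move/continuous_discreteP in fc; move/continuous_discreteP in gc.
  apply/continuous_discreteP => x; near=> y.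
  rewrite /GRing.add/=; congr (_ + _); first by near: y; exact: fc.
  by near: y; exact: gc.
- move=> a f /asboolP[fl fc]; apply/asboolP; split=> [b x y|].
    change (a *: f (b *: x + y) = b *: (a *: f x) + a *: f y).
    by rewrite fl scalerDr !scalerA mulrC.
  move/continuous_discreteP in fc.
  apply/continuous_discreteP => x; near=> y.
  change (a *: f y = a *: f x); congr (_ *: _); by near: y; exact: fc.
Unshelve. all: by end_near. Qed.

HB.instance Definition _ :=
  GRing.isSubmodClosed.Build K (V -> K^o) cont_dual_pred dual_pred_closed.

Definition cont_dual : lmodType K := sub_space cont_dual_pred.

Definition perp (P : submodClosed cont_dual) : {pred V} := fun v =>
  `[< forall chi : cont_dual, chi \in P -> val chi v = 0 >].

Lemma dual_linear (chi : cont_dual) : linear (val chi).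
Proof. by have /asboolP[] := valP chi. Qed.

Fact perp_closed P : subsemimod_closed (perp P).
Proof.
split; first split=> [|x y /asboolP xP /asboolP yP].
- apply/asboolP => chi _; have := dual_linear chi (-1) 0 0.
  by rewrite scaler0 addr0 scaleN1r addNr.
- apply/asboolP => chi chiP; rewrite -[x]scale1r dual_linear xP// yP//.
  by rewrite scaler0 addr0.
- move=> a x /asboolP xP; apply/asboolP => chi chiP.
  rewrite -[a *: x]addr0 dual_linear xP// scaler0 add0r.
  have := dual_linear chi (-1) 0 0.
  by rewrite scaler0 addr0 scaleN1r addNr.
Qed.

HB.instance Definition _ P :=
  GRing.isSubmodClosed.Build K V (perp P) (perp_closed P).

Variables (phi : {linear V -> V}) (phic : continuous phi).

Fact dual_map_subproof (chi : cont_dual) : val chi \o phi \in cont_dual_pred.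
Proof.
have /asboolP[chil chic] := valP chi; apply/asboolP; split.
  by move=> a x y; rewrite /= linearP chil.
by move=> x; apply: continuous_comp; [exact: phic|exact: chic].
Qed.

Definition dual_map (chi : cont_dual) : cont_dual :=
  exist _ (val chi \o phi) (dual_map_subproof chi).

Fact dual_map_is_linear : linear dual_map.
Proof. by move=> a chi1 chi2; apply/val_inj. Qed.

HB.instance Definition _ :=
  GRing.isLinear.Build K cont_dual cont_dual *:%R dual_map dual_map_is_linear.

Lemma perp_invariant (P : submodClosed cont_dual) :
  invariant_sub dual_map P -> invariant_sub phi (perp P).
Proof.
move=> Pinv x /asboolP xP; apply/asboolP => chi chiP.
exact: (xP (dual_map chi) (Pinv _ chiP)).
Qed.

End Duality.

Section Isomorphisms.
Variable K : fieldType.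

Definition lin_iso (W1 W2 : lmodType K) : Prop :=
  exists f : {linear W1 -> W2}, bijective f.

Definition top_iso (V1 V2 : topLmodType K) : Prop :=
  exists (f : {linear V1 -> V2}) (g : V2 -> V1),
    [/\ cancel f g, cancel g f, continuous f & continuous g].

Definition flow_top_iso (V1 V2 : topLmodType K)
    (phi1 : {linear V1 -> V1}) (phi2 : {linear V2 -> V2}) : Prop :=
  exists (f : {linear V1 -> V2}) (g : V2 -> V1),
    [/\ cancel f g, cancel g f, continuous f, continuous g &
        forall x, f (phi1 x) = phi2 (f x)].

End Isomorphisms.

(* Main.v *)
(* The Pinsker subspace of an algebraic flow W is its K['X]-torsion submodule: if
   every vector is torsion, each finite-dimensional subspace has a
   finite-dimensional orbit, while the orbit of a non-torsion vector is linearly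
   independent and yields entropy at least 1. Dually, a linearly compact flow has
   completely positive entropy iff its dual has no non-zero torsion functional:
   a torsion functional gives a non-zero finite-dimensional, hence zero-entropy,
   factor; a proper factor V / Z carries a non-zero functional chi on V that
   vanishes on Z, and if chi is not torsion, the open hyperplane ker chi of V / Z
   witnesses entropy at least 1. For D = P^perp with P the torsion of the dual, a
   torsion functional on D extends to V, is killed modulo P^perp^perp = P by a
   polynomial, and so is itself in P and vanishes on D; conversely torsion
   functionals restrict to torsion functionals. Hence D_+ = P^perp. *)

Require Import Defs.
From HB Require Import structures.
From mathcomp Require Import all_boot all_order all_algebra.
From mathcomp Require Import all_classical all_reals.
From mathcomp Require Import finmap topology ereal ereal_normedtype.

Set Implicit Arguments.
Unset Strict Implicit.
Unset Printing Implicit Defensive.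

Import Order.TTheory GRing.Theory Num.Theory numFieldTopology.Exports.

Local Open Scope classical_set_scope.
Local Open Scope ring_scope.

(** * Linear independence, bases and finite dimension *)

Section Families.
Variables (K : fieldType) (W : lmodType K).

Definition free_family n (b : 'I_n -> W) : Prop :=
  forall c : 'rV[K]_n, \sum_i c 0 i *: b i = 0 -> c = 0.

(** Bounds the dimension by [N] without having to produce a basis. *)
Definition rank_le N : Prop := forall b : 'I_N.+1 -> W, ~ free_family b.

Lemma is_basisP n (b : 'I_n -> W) :
  is_basis b <->
  free_family b /\ forall w, exists c : 'rV[K]_n, w = \sum_i c 0 i *: b i.
Proof.
split=> [[g gK Kg]|[bfree bspan]].
  split=> [c c0|w]; last by exists (g w); rewrite Kg.
  have /= E := gK 0; rewrite -(gK c) /= c0 -[RHS]E; congr g.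
  by rewrite big1// => i _; rewrite mxE scale0r.
pose g w : 'rV[K]_n := projT1 (cid (bspan w)).
have gP w : \sum_i g w 0 i *: b i = w by rewrite /g; case: cid.
exists g => // c; apply/eqP; rewrite -subr_eq0; apply/eqP/bfree.
under eq_bigr do rewrite !mxE scalerBl.
by rewrite big_split/= sumrN gP subrr.
Qed.

Lemma short_matrix_kernel m n (A : 'M[K]_(m, n)) : (n < m)%N ->
  exists2 c : 'rV[K]_m, c != 0 & c *m A = 0.
Proof.
move=> nm; have : kermx A != 0.
  rewrite -mxrank_eq0 mxrank_ker subn_eq0 -ltnNge.
  exact: leq_ltn_trans (rank_leq_col A) nm.
by case/rowV0Pn => c /sub_kermxP cA c0; exists c.
Qed.

(** The coordinates of the [#|I|.+1] vectors form a matrix with more rows than columns; a non-zero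
    row in its left kernel gives the relation. *)
Lemma dependent_span (I : finType) (e : I -> W) (a : 'I_#|I|.+1 -> W) :
  (forall j, exists c : I -> K, a j = \sum_i c i *: e i) ->
  exists2 c : 'rV[K]_#|I|.+1, c != 0 & \sum_j c 0 j *: a j = 0.
Proof.
move=> /boolp.choice[A aE].
have [c c0 cA] := short_matrix_kernel
  (\matrix_(j < #|I|.+1, i < #|I|) A j (enum_val i)) (ltnSn _).
exists c => //; under eq_bigr => j _ do rewrite aE scaler_sumr.
rewrite exchange_big/= big1// => i _.
have /rowP/(_ (enum_rank i)) := cA; rewrite !mxE => cAi.
under eq_bigr do rewrite scalerA.
rewrite -scaler_suml -[X in X *: _](_ : 0 = _) ?scale0r// -[LHS]cAi.
by apply: eq_bigr => j _; rewrite mxE enum_rankK.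
Qed.

Lemma rank_le_span (I : finType) (e : I -> W) :
  (forall w, exists c : I -> K, w = \sum_i c i *: e i) -> rank_le #|I|.
Proof.
move=> espan b bfree; have [//|c /eqP c0 cb] := @dependent_span I e b.
exact/c0/bfree.
Qed.

Lemma is_basis_rank_le n (b : 'I_n -> W) : is_basis b -> rank_le n.
Proof.
move=> /is_basisP[_ bspan]; rewrite -[n]card_ord; apply: (rank_le_span (e := b)).
by move=> w; have [c ->] := bspan w; exists (c 0).
Qed.

Lemma free_family_widen m n (b : 'I_n -> W) (mn : (m <= n)%N) :
  free_family b -> free_family (b \o widen_ord mn).
Proof.
(* [d] pads [c] with zeros up to length [n]. *)
move=> bfree c c0; pose d : 'rV[K]_n := \row_i oapp (c 0) 0 (insub (val i)).
have dE j : d 0 (widen_ord mn j) = c 0 j.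
  by rewrite mxE /= valK.
have d0 : d = 0.
  apply: bfree; rewrite -[RHS]c0.
  rewrite (bigID (fun i : 'I_n => (i < m)%N))/= [X in _ + X]big1 ?addr0.
    by rewrite (big_ord_narrow mn)/=; apply: eq_bigr => i _; rewrite dE.
  by move=> i im; rewrite mxE insubF ?scale0r//; apply/negbTE.
by apply/rowP => j; rewrite -dE d0 !mxE.
Qed.

Lemma rank_le_free N n (b : 'I_n -> W) : rank_le N -> free_family b -> (n <= N)%N.
Proof.
move=> WN bfree; rewrite leqNgt; apply/negP => Nn.
exact: WN (free_family_widen (mn := Nn) bfree).
Qed.

Lemma dimension_basis (R : realType) n (b : 'I_n -> W) :
  is_basis b -> dimension R W = (n%:R)%:E.
Proof.
move=> bb; rewrite /dimension (_ : [set n | _] = [set n]).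
  by rewrite image_set1 ereal_inf1.
apply/seteqP; split=> [m [b' bb']|_ ->]; last by exists b.
have [/is_basisP[bf _] /is_basisP[bf' _]] := (bb, bb').
apply/eqP; rewrite eqn_leq.
rewrite (rank_le_free (is_basis_rank_le bb) bf')/=.
exact: (rank_le_free (is_basis_rank_le bb') bf).
Qed.

(** An independent family of maximal length, which exists because the lengths are bounded, is a
    basis. *)
Lemma rank_le_dimension (R : realType) N : rank_le N ->
  exists2 m, (m <= N)%N & dimension R W = (m%:R)%:E.
Proof.
move=> WN.
have ex_free : exists n, `[< exists b : 'I_n -> W, free_family b >].
  exists 0%N; apply/asboolP; exists (fun=> 0) => c _; exact: thinmx0.
have free_leN n : `[< exists b : 'I_n -> W, free_family b >] -> (n <= N)%N.
  by move=> /asboolP[b]; exact: rank_le_free.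
case: (ex_maxnP ex_free free_leN) => n nfree nmax.
have nN := free_leN _ nfree.
case/asboolP: nfree => b bfree.
exists n => //; apply: (dimension_basis R (b := b)); apply/is_basisP; split=> // w.
(* [b] with [w] appended. By maximality [b'] is dependent, and since [b] is free the coefficient of
   [w] in a relation is non-zero, so the relation can be solved for [w]. *)
pose b' (i : 'I_(n + 1)) := if fintype.split i is inl j then b j else w.
have b'sum (c : 'rV[K]_(n + 1)) : \sum_i c 0 i *: b' i =
    \sum_i c 0 (lshift 1 i) *: b i + c 0 (rshift n ord0) *: w.
  rewrite big_split_ord/= big_ord_recl big_ord0 addr0; congr (_ + _).
    apply: eq_bigr => i _; rewrite /b'.
    case: fintype.splitP => k => [/= /val_inj<-//|/= E].
    by have := ltn_ord i; rewrite E ltnNge leq_addr.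
  by rewrite /b' (unsplitK (inr _)).
have [c [c0 cb]] : exists c : 'rV[K]_(n + 1),
    c <> 0 /\ \sum_i c 0 i *: b' i = 0.
  apply: contrapT => /forallNP H.
  have : (n + 1 <= n)%N.
    apply: nmax; apply/asboolP; exists b' => c cb; apply: contrapT => c0.
    exact: (H c).
  by rewrite addn1 ltnn.
have cw : c 0 (rshift n ord0) != 0.
  apply/eqP => cw; apply: c0; rewrite b'sum cw scale0r addr0 in cb.
  have lc0 : lsubmx c = 0.
    by apply: bfree; rewrite -[RHS]cb; apply: eq_bigr => i _; rewrite mxE.
  rewrite -[c]hsubmxK lc0 (_ : rsubmx c = 0) ?row_mx0//.
  by apply/rowP => i; rewrite !mxE ord1.
exists (- (c 0 (rshift n ord0))^-1 *: lsubmx c).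
apply: (scalerI cw); rewrite scaler_sumr; move/eqP: cb.
rewrite b'sum addrC addr_eq0 => /eqP ->; rewrite -sumrN.
apply: eq_bigr => i _.
by rewrite !mxE scalerA mulrA mulrN divff// mulN1r scaleNr.
Qed.

End Families.

(** * Dimensions of quotients and limits of their averages *)

Section QuotientDimension.
Variables (K : fieldType) (V : lmodType K).
Implicit Types A B U : submodClosed V.

Lemma val_lincomb U n (c : 'I_n -> K) (a : 'I_n -> sub_space U) :
  val (\sum_i c i *: a i) = \sum_i c i *: val (a i).
Proof. by apply: (big_ind2 (fun x y => val x = y)) => // x1 x2 y1 y2 <- <-. Qed.

Lemma quot_pi_lincomb U n (c : 'I_n -> K) (a : 'I_n -> V) :
  quot_pi U (\sum_i c i *: a i) = \sum_i c i *: quot_pi U (a i).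
Proof. by rewrite linear_sum; apply: eq_bigr => i _; rewrite linearZ. Qed.

Lemma quot_pi_eq0 U x : quot_pi U x = 0 <-> x \in U.
Proof. by rewrite -(linear0 (quot_pi U)) quot_piP subr0. Qed.

End QuotientDimension.

Section DimQuot.
Variables (R : realType) (K : fieldType) (V : lmodType K).
Implicit Types A B U : submodClosed V.

Lemma mem_trace A B (x : sub_space A) : (x \in trace_sub B) = (val x \in B).
Proof. by []. Qed.

(** Dependence is tested on vectors of [V] instead of classes: a combination landing in [B] is a
    relation in the quotient. *)
Lemma dim_quot_le A B N :
  (forall a : 'I_N.+1 -> V, (forall i, a i \in A) ->
     exists2 c : 'rV[K]_N.+1, c != 0 & \sum_i c 0 i *: a i \in B) ->
  exists2 m, (m <= N)%N & dim_quot R A B = (m%:R)%:E.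
Proof.
move=> dep; apply: rank_le_dimension => b bfree.
have [|c /eqP c0 cB] := dep (fun i => val (repr (b i))).
  by move=> i; exact: valP.
apply: c0; apply: bfree.
under eq_bigr do rewrite -[b _]quot_pi_repr.
by rewrite -quot_pi_lincomb; apply/quot_pi_eq0; rewrite mem_trace val_lincomb.
Qed.

Lemma dim_quot_eq A B n (b : 'I_n -> V) :
  (forall i, b i \in A) ->
  (forall a, a \in A -> exists c : 'rV[K]_n, a - \sum_i c 0 i *: b i \in B) ->
  (forall c : 'rV[K]_n, \sum_i c 0 i *: b i \in B -> c = 0) ->
  dim_quot R A B = (n%:R)%:E.
Proof.
move=> bA bspan bfree; pose b' i : sub_space A := exist _ (b i) (bA i).
apply: (dimension_basis R (b := fun i => quot_pi (trace_sub B) (b' i))).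
apply/is_basisP; split=> [c|q].
  rewrite -quot_pi_lincomb => /quot_pi_eq0; rewrite mem_trace val_lincomb.
  exact: bfree.
have [c cB] := bspan _ (valP (repr q)); exists c.
rewrite -quot_pi_lincomb -[LHS]quot_pi_repr; apply/quot_piP.
by rewrite mem_trace /= val_lincomb.
Qed.

End DimQuot.

(** [d n] differs from [n * c] by at most [N], an error that division by [n] makes vanish. The
    bounds are additive because natural subtraction truncates. *)
Lemma lim_average (R : realType) (d : nat -> \bar R) c N :
  (forall n, (0 < n)%N -> exists m,
     [/\ d n = (m%:R)%:E, (m <= n * c + N)%N & (n * c <= m + N)%N]) ->
  lim ((fun n => (n%:R^-1)%:E * d n)%E @ \oo) = (c%:R)%:E.
Proof.
move=> dP; apply/cvg_lim; first exact: ereal_hausdorff.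
move=> A cA; have /nbhs_ballP[e /= e0 eA] : nbhs (c%:R : R) (A \o EFin) := cA.
rewrite /= nbhs_simpl /=.
near=> n.
have n0 : (0 < n)%N by near: n; exact: nbhs_infty_gt.
have nR0 : 0 < n%:R :> R by rewrite ltr0n.
have [m [dn mle mge]] := dP n n0; rewrite /= dn -EFinM; apply: (eA (_ * _)) => /=.
rewrite /ball/= -[X in X - _](mulKf (lt0r_neq0 nR0)) -mulrBr normrM.
rewrite gtr0_norm ?invr_gt0// mulrC ltr_pdivrMr//.
apply: (@le_lt_trans _ _ N%:R); last first.
  rewrite mulrC -ltr_pdivrMr//; near: n.
  (* Beyond this threshold the error [N] is smaller than [n * e]. *)
  apply: filterS (nbhs_infty_ger (N%:R / e + 1)) => k; apply: lt_le_trans.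
  by rewrite ltrDl.
rewrite -natrM ler_norml lerBrDl lerBlDr lerBlDr.
by rewrite -!natrD !ler_nat mle addnC mge.
Unshelve. all: by end_near. Qed.

(** Packages a propositional subspace as a [submodClosed] through classical decidability, so that
    proofs can introduce auxiliary subspaces on the spot. *)
Lemma submod_exists (K : fieldType) (V : lmodType K) (P : V -> Prop) :
  P 0 -> (forall a x y, P x -> P y -> P (a *: x + y)) ->
  exists U : submodClosed V, forall x, x \in U <-> P x.
Proof.
move=> P0 Plin; pose S : {pred V} := fun x => `[< P x >].
have SP x : x \in S <-> P x by split => /asboolP.
have S_closed : subsemimod_closed S.
  split; first split=> [|x y /SP xS /SP yS]; first exact/SP.
    by apply/SP; rewrite -[x]scale1r; exact: Plin.
  by move=> a x /SP xS; apply/SP; rewrite -[a *: x]addr0; exact: Plin.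
pose mS := GRing.isSubmodClosed.Build K V S S_closed.
pose U : submodClosed V := HB.pack S mS.
by exists U.
Qed.

Lemma largest_uniq (K : fieldType) (V : lmodType K) (P : submodClosed V -> Prop) D :
  is_largest P D -> largest P =i D.
Proof.
move=> DP; rewrite /largest; case: xgetP => [E _ [PE Emax]|/(_ D)//] x.
by apply/idP/idP; [apply: DP.2|apply: Emax; case: DP].
Qed.

(** * The polynomial module structure of a flow and its torsion *)

Section PolynomialAction.
Variables (K : fieldType) (W : lmodType K) (psi : {linear W -> W}).
Implicit Types (p q : {poly K}) (x y : W).

(** The operator p([psi]) applied to [x]: [W] as a module over [{poly K}] with ['X] acting as
    [psi]. *)
Definition poly_act p x : W := \sum_(i < size p) p`_i *: iter i psi x.

Lemma poly_act_widen n p x : (size p <= n)%N ->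
  poly_act p x = \sum_(i < n) p`_i *: iter i psi x.
Proof.
move=> pn; rewrite /poly_act (big_ord_widen _ (fun i => p`_i *: iter i psi x) pn).
rewrite big_mkcond/=; apply: eq_bigr => i _; case: ltnP => // ip.
by rewrite nth_default// scale0r.
Qed.

Lemma poly_act_linear p : linear (poly_act p).
Proof.
move=> a x y; rewrite /poly_act scaler_sumr -big_split/=.
by apply: eq_bigr => i _; rewrite iter_linear scalerDr !scalerA mulrC.
Qed.

HB.instance Definition _ p :=
  GRing.isLinear.Build K W W *:%R (poly_act p) (poly_act_linear p).

Lemma poly_actDl p q x : poly_act (p + q) x = poly_act p x + poly_act q x.
Proof.
have pn := leq_maxl (size p) (size q); have qn := leq_maxr (size p) (size q).
rewrite (poly_act_widen x pn) (poly_act_widen x qn).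
rewrite (poly_act_widen x (size_polyD p q)) -big_split/=.
by apply: eq_bigr => i _; rewrite coefD scalerDl.
Qed.

Lemma poly_actC c x : poly_act c%:P x = c *: x.
Proof.
by rewrite (poly_act_widen x (size_polyC_leq1 c)) big_ord1 coefC.
Qed.

Lemma poly_act0 x : poly_act 0 x = 0.
Proof. by rewrite -polyC0 poly_actC scale0r. Qed.

Lemma poly_actMX p x : poly_act (p * 'X) x = poly_act p (psi x).
Proof.
have pn : (size (p * 'X)%R <= (size p).+1)%N.
  by apply: leq_trans (size_polyMleq _ _) _; rewrite size_polyX addn2.
rewrite (poly_act_widen x pn) big_ord_recl coefMX/= scale0r add0r.
by apply: eq_bigr => i _; rewrite coefMX/= -iterSr.
Qed.

Lemma poly_act_comm p x : poly_act p (psi x) = psi (poly_act p x).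
Proof.
rewrite linear_sum; apply: eq_bigr => i _.
by rewrite linearZ -iterSr.
Qed.

Lemma poly_actM p q x : poly_act (p * q) x = poly_act p (poly_act q x).
Proof.
elim/poly_ind: p x => [|p c IH] x; first by rewrite mul0r !poly_act0.
rewrite mulrDl !poly_actDl -mulrA ['X * q]mulrC mulrA !poly_actMX IH.
rewrite poly_act_comm; congr (_ + _).
rewrite poly_actC mul_polyC (poly_act_widen x (size_scale_leq c q)) scaler_sumr.
by apply: eq_bigr => i _; rewrite coefZ scalerA.
Qed.

Lemma poly_actXn n x : poly_act 'X^n x = iter n psi x.
Proof.
elim: n x => [|n IH] x; first by rewrite expr0 poly_actC scale1r.
by rewrite exprSr poly_actMX IH -iterSr.
Qed.

Lemma poly_act_rVpoly n (c : 'rV[K]_n) x :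
  poly_act (rVpoly c) x = \sum_i c 0 i *: iter i psi x.
Proof.
rewrite (poly_act_widen x (size_poly n _)).
by apply: eq_bigr => i _; rewrite coef_rVpoly_ord.
Qed.

(** Euclidean division of ['X^n] by [p]. Since the remainder is shorter than [p], the whole orbit of
    [x] lies in the span of its first iterates, fewer than [size p] of them. *)
Lemma iter_annihilated p x n : p != 0 -> poly_act p x = 0 ->
  iter n psi x = poly_act ('X^n %% p) x.
Proof.
move=> p0 px; rewrite -poly_actXn {1}(divp_eq 'X^n p) poly_actDl poly_actM px.
by rewrite linear0 add0r.
Qed.

Definition torsion x : Prop := exists2 p, p != 0 & poly_act p x = 0.

Lemma torsion0 : torsion 0.
Proof. by exists 1; rewrite ?oner_neq0// linear0. Qed.

(** Polynomials commute, so the product of two annihilators kills both vectors. *)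
Lemma torsion_lin a x y : torsion x -> torsion y -> torsion (a *: x + y).
Proof.
move=> [p p0 px] [q q0 qy]; exists (p * q); first by rewrite mulf_neq0.
rewrite linearP/= [in X in _ + X]poly_actM qy linear0 addr0.
by rewrite mulrC poly_actM px linear0 scaler0.
Qed.

Lemma torsion_map x : torsion x -> torsion (psi x).
Proof. by move=> [p p0 px]; exists p; rewrite // poly_act_comm px linear0. Qed.

Lemma torsion_poly_act q x : q != 0 -> torsion (poly_act q x) -> torsion x.
Proof.
by move=> q0 [p p0 pqx]; exists (p * q); rewrite ?mulf_neq0// poly_actM.
Qed.

(** Through [rVpoly], a non-trivial relation among the iterates is a non-zero polynomial
    annihilating [x]. *)
Lemma not_torsion_free n x : ~ torsion x ->
  free_family (fun i : 'I_n => iter i psi x).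
Proof.
move=> xt c cx; apply: (can_inj rVpolyK); rewrite linear0.
apply/eqP/negPn/negP => c0; apply: xt; exists (rVpoly c) => //.
by rewrite poly_act_rVpoly.
Qed.

Lemma torsion_submod :
  exists2 U : submodClosed W, invariant_sub psi U & forall x, x \in U <-> torsion x.
Proof.
have [U UP] := submod_exists torsion0 torsion_lin.
by exists U => // x /UP xU; apply/UP/torsion_map.
Qed.

End PolynomialAction.

(** * Algebraic entropy vanishes exactly on torsion flows *)

Section AlgebraicEntropy.
Variables (R : realType) (K : fieldType).

Lemma iter_restr (W : lmodType K) (psi : {linear W -> W}) (Z : submodClosed W)
    (psiZ : invariant_sub psi Z) n z :
  val (iter n (restr_map psiZ) z) = iter n psi (val z).
Proof. by elim: n => //= n ->. Qed.

Lemma poly_act_restr (W : lmodType K) (psi : {linear W -> W}) (Z : submodClosed W)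
    (psiZ : invariant_sub psi Z) p z :
  val (poly_act (restr_map psiZ) p z) = poly_act psi p (val z).
Proof. by rewrite val_lincomb; apply: eq_bigr => i _; rewrite iter_restr. Qed.

Lemma torsion_restr (W : lmodType K) (psi : {linear W -> W}) (Z : submodClosed W)
    (psiZ : invariant_sub psi Z) z :
  torsion (restr_map psiZ) z <-> torsion psi (val z).
Proof.
split=> -[p p0 pz]; exists p => //; first by rewrite -(poly_act_restr psiZ) pz.
by apply: val_inj; rewrite poly_act_restr.
Qed.

Variables (W : lmodType K) (psi : {linear W -> W}).

(** The finitely many basis vectors of [U] have a common annihilator [P], so all iterates of [U]
    stay in the span of the finite family [e]. The trajectory quotients thus have bounded
    dimension. *)
Lemma ent_alg_torsion : (forall x, torsion psi x) -> ent_alg R psi = 0%E.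
Proof.
move=> Wt; rewrite /ent_alg (_ : image _ _ = [set 0%E]) ?ereal_sup1//.
have lim0 (U : submodClosed W) : finite_dimensional (sub_space U) ->
    lim ((fun n => (n%:R^-1)%:E * dim_quot R (traj psi U n) U)%E @ \oo) = 0%E.
  move=> [k [b /is_basisP[_ bspan]]].
  have /boolp.choice[p pP] : forall j, exists p : {poly K},
      p != 0 /\ poly_act psi p (val (b j)) = 0.
    by move=> j; have [p] := Wt (val (b j)); exists p.
  pose P : {poly K} := \prod_j p j; pose d := size P.
  have P0 : P != 0 by apply/prodf_neq0 => j _; case: (pP j).
  have PU u : u \in U -> poly_act psi P u = 0.
    move=> uU; have [c uE] := bspan (exist _ u uU).
    rewrite (_ : u = \sum_j c 0 j *: val (b j)); last by rewrite -val_lincomb -uE.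
    rewrite linear_sum big1// => j _; rewrite linearZ/=.
    rewrite /P (bigD1 j)//= mulrC poly_actM (pP j).2 linear0.
    by rewrite scaler0.
  pose e (ij : 'I_d * 'I_k) := iter ij.1 psi (val (b ij.2)).
  have espan u n : u \in U ->
      exists c : 'I_d * 'I_k -> K, iter n psi u = \sum_ij c ij *: e ij.
    move=> uU; have [c uE] := bspan (exist _ u uU).
    have {}uE : u = \sum_j c 0 j *: val (b j) by rewrite -val_lincomb -uE.
    exists (fun ij : 'I_d * 'I_k => ('X^n %% P)`_(ij.1) * c 0 ij.2).
    rewrite (iter_annihilated n P0 (PU u uU)).
    rewrite (@poly_act_widen _ _ _ d); last by rewrite ltnW// ltn_modp.
    rewrite -(pair_bigA _ (fun (i : 'I_d) (j : 'I_k) =>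
      (('X^n %% P)`_i * c 0 j) *: e (i, j)))/=.
    apply: eq_bigr => i _; rewrite uE.
    have iterE : iter i psi =1 poly_act psi 'X^i by move=> x; rewrite poly_actXn.
    rewrite iterE [poly_act _ _ _]linear_sum scaler_sumr; apply: eq_bigr => j _.
    by rewrite linearZ/= -iterE scalerA.
  rewrite (lim_average (c := 0) (N := #|{: 'I_d * 'I_k}|))// => n n0.
  have [|m mN ->] := @dim_quot_le R K W (traj psi U n) U #|{: 'I_d * 'I_k}|.
    move=> a aT; have [|c c0 ca] := @dependent_span _ _ _ e a; last first.
      by exists c => //; rewrite ca rpred0.
    move=> j; have /asboolP[u [uU ->]] := aT j.
    have /boolp.choice[c cE] := fun i => espan (u i) i (uU i).
    exists (fun ij => \sum_i c i ij); under eq_bigr do rewrite cE.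
    rewrite exchange_big/=; apply: eq_bigr => ij _.
    by rewrite scaler_suml.
  by exists m; split; rewrite // muln0// add0n.
apply/seteqP; split=> [_ [U Ufd <-]|_ ->]; first exact: lim0.
(* The zero subspace keeps the supremum from ranging over the empty set, where it would be -oo. *)
pose Z : submodClosed W := zero_sub (V := W).
have Zfd : finite_dimensional (sub_space Z).
  exists 0%N, (fun=> 0); apply/is_basisP; split=> [c _|w]; first exact: thinmx0.
  by exists 0; rewrite big_ord0; apply/val_inj/eqP; exact: (valP w).
by exists Z => //; exact: lim0.
Qed.

(** [U] is the line through [x]. Modulo [U], the trajectory of length [n.+1] has as basis the
    iterates of [x] of exponents 1 to [n]; its dimension is one less than its length, and the
    averages tend to 1. *)
Lemma ent_alg_not_torsion x : ~ torsion psi x -> ent_alg R psi != 0%E.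
Proof.
move=> xt.
have [||U UP] := @submod_exists _ W (fun y => exists a, y = a *: x).
- by exists 0; rewrite scale0r.
- by move=> a _ _ [b ->] [c ->]; exists (a * b + c); rewrite scalerDl scalerA.
have xU : x \in U by apply/UP; exists 1; rewrite scale1r.
have Ufd : finite_dimensional (sub_space U).
  exists 1%N, (fun=> exist _ x xU); apply/is_basisP; split=> [c cx|w].
    apply: (not_torsion_free xt (n := 1)); rewrite big_ord1/=.
    by move/(congr1 val): cx; rewrite big_ord1.
  have [a wE] := (UP _).1 (valP w); exists a%:M; apply: val_inj.
  by rewrite big_ord1 mxE eqxx mulr1n /= wE.
have lim1 : lim ((fun n => (n%:R^-1)%:E * dim_quot R (traj psi U n) U)%E @ \oo) = 1%E.
  rewrite (lim_average (c := 1) (N := 1))// => -[//|n] _; exists n.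
  rewrite muln1 !addn1 leqnn leqW//; split=> //.
  apply: (dim_quot_eq R (b := fun i => iter i.+1 psi x)) => [i|a|c].
  - apply/asboolP; exists (fun j => if j == lift ord0 i then x else 0).
    split=> [j|]; first by case: ifP => // _; exact: rpred0.
    rewrite (bigD1 (lift ord0 i))//= eqxx big1 ?addr0// => j /negbTE ->.
    by rewrite -poly_actXn linear0.
  - move=> /asboolP[u [uU ->]].
    have /boolp.choice[c cE] := fun i => (UP (u i)).1 (uU i).
    exists (\row_i c (lift ord0 i)); rewrite big_ord_recl/=.
    rewrite [X in _ + X - _](_ : _ =
        \sum_i (\row_i c (lift ord0 i)) 0 i *: iter i.+1 psi x).
      by rewrite addrK.
    apply: eq_bigr => i _; rewrite mxE cE /=.
    by rewrite -!iterS -!poly_actXn linearZ.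
  - move=> /UP[a cx].
    (* A relation modulo the line becomes a relation among all iterates once the multiple [a] of [x]
       is put in front with the opposite sign. *)
    pose c' : 'rV[K]_(1 + n) := row_mx (- a)%:M c.
    have c'0 : c' = 0.
      apply: (not_torsion_free xt); rewrite big_split_ord/= big_ord1.
      rewrite row_mxEl mxE eqxx mulr1n/= -[X in _ + X](_ : a *: x = _) ?scaleNr ?addNr//.
      by rewrite -cx; apply: eq_bigr => i _; rewrite row_mxEr.
    by have /rowP cE := c'0; apply/rowP => i; rewrite -(row_mxEr (- a)%:M) cE !mxE.
rewrite gt_eqF//; apply: (@lt_le_trans _ _ 1%E); first exact: lte01.
by apply: ereal_sup_ubound; exists U.
Qed.

Lemma ent_alg_eq0 : ent_alg R psi = 0%E <-> forall x, torsion psi x.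
Proof.
split=> [W0 x|]; last exact: ent_alg_torsion.
by apply: contrapT => /ent_alg_not_torsion/eqP.
Qed.

End AlgebraicEntropy.

(** * The Pinsker subspace as torsion submodule *)

Section AlgebraicPinsker.
Variables (R : realType) (K : fieldType) (W : lmodType K) (psi : {linear W -> W}).

(** By [ent_alg_eq0] the invariant subspaces of zero entropy are those made of torsion vectors. The
    torsion submodule is the largest of them, so [largest] does not fall back on its default. *)
Lemma mem_Palg x : x \in Palg R psi <-> torsion psi x.
Proof.
have [T Tinv TP] := torsion_submod psi.
rewrite -TP (largest_uniq (D := T))//; split.
  exists Tinv; apply/ent_alg_eq0 => z; apply/torsion_restr/TP; exact: valP.
move=> Z [Zinv /ent_alg_eq0 Zt] z zZ; apply/TP.
exact: (torsion_restr Zinv (exist _ z zZ)).1.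
Qed.

Lemma cp_ent_algP :
  cp_ent_alg R psi <-> forall x, torsion psi x -> x = 0.
Proof.
split=> [Wcp x xt|Wt Z Zinv [x xZ x0]].
  have [T Tinv TP] := torsion_submod psi.
  apply/eqP/negPn/negP => x0; have /eqP := Wcp T Tinv (ex_intro2 _ _ x ((TP x).2 xt) x0).
  by apply; apply/ent_alg_eq0 => z; apply/torsion_restr/TP; exact: valP.
apply: (@ent_alg_not_torsion R K _ (restr_map Zinv) (exist _ x xZ)) => /torsion_restr/Wt/eqP.
by rewrite (negbTE x0).
Qed.

End AlgebraicPinsker.

(* rpredN and rpredB do not apply to submodClosed, see [zmod_of]. *)
Section SubmodOpposite.
Variables (K : fieldType) (V : lmodType K) (U : submodClosed V).

Lemma submodN x : x \in U -> - x \in U.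
Proof. by rewrite -scaleN1r; exact: rpredZ. Qed.

Lemma submodB x y : x \in U -> y \in U -> x - y \in U.
Proof. by move=> xU yU; rewrite rpredD// submodN. Qed.

End SubmodOpposite.

(** * Translations, and subspaces that are neighbourhoods of 0 *)

Section TopologicalVectorSpace.
Variables (K : fieldType) (V : topLmodType K).
Hypothesis V_tvs : topological_vector_space V.
Implicit Types (A B : set V) (U Y : submodClosed V).

Lemma nbhs_translate (a x : V) A : nbhs (a + x) A -> nbhs x (fun y => A (a + y)).
Proof.
move=> /(V_tvs.1 (a, x))[[B C]] /= [aB xC] BC.
by apply: filterS xC => y Cy; apply: (BC (a, y)); split => //=; exact: nbhs_singleton.
Qed.

Lemma nbhs_shift (x : V) A : nbhs x A <-> nbhs 0 (fun y => A (x + y)).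
Proof.
split=> [xA|A0]; first by apply: nbhs_translate; rewrite addr0.
have := @nbhs_translate (- x) x (fun y => A (x + y)).
rewrite addNr => /(_ A0); apply: filterS => y.
by rewrite addrA subrr add0r.
Qed.

Lemma open_submod U : nbhs 0 [set` U] -> open [set` U].
Proof.
move=> U0; rewrite openE => x /= xU; rewrite /interior; apply/nbhs_shift.
by apply: filterS U0 => y /= yU; rewrite rpredD.
Qed.

(** The complement of [U] contains, with each point, its coset modulo [U]. *)
Lemma closed_submod U : nbhs 0 [set` U] -> closed [set` U].
Proof.
move=> U0; rewrite -openC openE => x /= xU; rewrite /interior; apply/nbhs_shift.
apply: filterS U0 => y /= yU xyU; apply: xU.
by have := submodB xyU yU; rewrite addrK.
Qed.

(** Being constant on the cosets of [U], the map is locally constant, which is continuity into the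
    discrete field. *)
Lemma continuous_functional (f : V -> K^o) U :
  linear f -> nbhs 0 [set` U] -> (forall u, u \in U -> f u = 0) ->
  exists chi : cont_dual V, val chi = f.
Proof.
move=> fl U0 fU.
have fP : f \in @cont_dual_pred K V.
  apply/asboolP; split=> //; apply/continuous_discreteP => x; apply/nbhs_shift.
  by apply: filterS U0 => u /= uU; rewrite -[x]scale1r fl (fU u uU) addr0 !scale1r.
by exists (exist _ f fP).
Qed.

End TopologicalVectorSpace.

(* A head symbol of its own for [val], from which a linear structure is inferred. *)
Definition ev (K : fieldType) (V : topLmodType K) (chi : cont_dual V) : V -> K^o :=
  val chi.

HB.instance Definition _ (K : fieldType) (V : topLmodType K) (chi : cont_dual V) :=
  GRing.isLinear.Build K V K^o *:%R (ev chi) (dual_linear chi).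

(** * Continuous functionals and separation from closed subspaces *)

Section Functionals.
Variables (K : fieldType) (V : topLmodType K).
Implicit Types (chi : cont_dual V) (Y : submodClosed V).

Lemma dual_ext chi1 chi2 : ev chi1 =1 ev chi2 -> chi1 = chi2.
Proof. by move=> E; apply: val_inj; apply: funext => x; exact: E. Qed.

Lemma ev_lin a chi1 chi2 x : ev (a *: chi1 + chi2) x = a * ev chi1 x + ev chi2 x.
Proof. by []. Qed.

Lemma ev0 x : ev (0 : cont_dual V) x = 0.
Proof. by []. Qed.

Lemma ev_sum n (c : 'I_n -> K) (chi : 'I_n -> cont_dual V) x :
  ev (\sum_i c i *: chi i) x = \sum_i c i * ev (chi i) x.
Proof.
apply: (big_ind2 (fun (h : cont_dual V) y => ev h x = y)) => //.
by move=> h1 y1 h2 y2 <- <-.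
Qed.

Lemma near_ev chi x : \forall y \near x, ev chi y = ev chi x.
Proof.
by have /asboolP[_ /continuous_discreteP/(_ x)] := valP chi.
Qed.

Lemma closed_forall_ev I (chi : I -> cont_dual V) (a : I -> K) :
  closed [set x | forall i, ev (chi i) x = a i].
Proof.
rewrite -openC openE => x /= /existsNP[i xi].
by apply: filterS (near_ev (chi i) x) => y /= E /(_ i); rewrite E.
Qed.

Lemma closed_ev chi a : closed [set x | ev chi x = a].
Proof.
rewrite -openC openE => x /= xa.
by apply: filterS (near_ev chi x) => y /= ->.
Qed.

(* A subspace containing H that is maximal among those avoiding v is a
   complement of the line through v. *)
Lemma functional_extension (H : submodClosed V) v : v \notin H ->
  exists f : V -> K^o, [/\ linear f, f v = 1 & forall h, h \in H -> f h = 0].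
Proof.
move=> vH.
(* Zorn's lemma also tests the empty chain, whose union is empty; hence [H] is only required to lie
   in the non-empty sets. *)
pose P (A : set V) := [/\ forall a x y, A x -> A y -> A (a *: x + y), ~ A v &
  A !=set0 -> [set` H] `<=` A].
have [F FP Ftot|A [[Alin Av AH] Amax]] := @Zorn_bigcup V P.
  split=> [a x y [B FB Bx] [C FC Cy]|[B FB Bv]|[x [B FB Bx]]].
  - have [BC|CB] := Ftot B C FB FC.
      by exists C => //; have [Cl _ _] := FP C FC; apply: Cl => //; exact: BC.
    by exists B => //; have [Bl _ _] := FP B FB; apply: Bl => //; exact: CB.
  - by have [_ nBv _] := FP B FB.
  - move=> h hH; exists B => //; have [_ _ HB] := FP B FB; apply: HB => //.
    by exists x.
have {}AH : [set` H] `<=` A.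
  have [/AH//|A0] := pselect (A !=set0).
  exfalso; apply: (Amax [set` H]).
    split=> [x Ax|HA]; first by case: A0; exists x.
    by apply: A0; exists 0; apply: HA => /=; exact: rpred0.
  split=> [a x y /= xH yH| |_]; last exact: subset_refl.
    by rewrite rpredD// rpredZ.
  by move=> /= vH'; rewrite vH' in vH.
have A0 : A 0 by apply: AH => /=; exact: rpred0.
have AZ a x : A x -> A (a *: x) by move=> Ax; rewrite -[_ *: _]addr0; exact: Alin.
have AB x y : A x -> A y -> A (x - y).
  by move=> Ax Ay; rewrite addrC -scaleN1r; exact: Alin.
have Auniq x a b : A (x - a *: v) -> A (x - b *: v) -> a = b.
  move=> Aa Ab; apply/eqP/negPn/negP; rewrite -subr_eq0 => ab; apply: Av.
  rewrite -[v](scalerK ab); apply: AZ.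
  rewrite (_ : _ *: v = (x - b *: v) - (x - a *: v)); first exact: AB.
  by rewrite opprB [RHS]addrC addrA subrK scalerBl.
have Aex x : exists a, A (x - a *: v).
  have [Ax|Ax] := pselect (A x); first by exists 0; rewrite scale0r subr0.
  (* [B] is the span of [A] and [x]. By maximality it contains [v], and the coefficient of [x] is
     invertible because [v] is not in [A]. *)
  pose B : set V := [set y | exists b, A (y - b *: x)].
  have AB' : A `<` B.
    split=> [y Ay|BA]; first by exists 0; rewrite scale0r subr0.
    by apply: Ax; apply: BA; exists 1; rewrite scale1r subrr.
  have Blin a y z : B y -> B z -> B (a *: y + z).
    move=> [b yb] [c zc]; exists (a * b + c).
    rewrite scalerDl opprD addrACA -scalerA -scalerBr; exact: Alin.
  have : B v.
    apply: contrapT => Bv; apply: (Amax B AB'); split=> // _ h hH.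
    by apply: AB'.1; exact: AH.
  move=> [b vb]; have b0 : b != 0.
    by apply/eqP => b0; apply: Av; rewrite b0 scale0r subr0 in vb.
  exists b^-1; have := AZ (- b^-1) _ vb.
  by rewrite scaleNr scalerBr scalerK// opprB.
have /boolp.choice[f fP] := Aex.
exists f; split=> [a x y||h hH].
- apply: (Auniq (a *: x + y) _ (a * f x + f y)) => //.
  by rewrite scalerDl opprD addrACA -scalerA -scalerBr; exact: Alin.
- by apply: (Auniq v) => //; rewrite scale1r subrr.
- by apply: (Auniq h) => //; rewrite scale0r subr0; exact: AH.
Qed.

Hypothesis V_lt : linearly_topologized V.

Let V_tvs : topological_vector_space V. Proof. by case: V_lt. Qed.

Lemma closed_submod_avoid Y v : closed [set` Y] -> v \notin Y ->
  exists2 U : submodClosed V, nbhs 0 [set` U] & forall u, u \in U -> v + u \notin Y.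
Proof.
move=> /closed_openC Yo vY.
have : nbhs v (~` [set` Y]) by apply: open_nbhs_nbhs; split=> //; exact/negP.
case: V_lt => _ _ basis /(nbhs_shift V_tvs)/basis[U [U0 UY]].
by exists U => // u /UY /negP.
Qed.

(** By the choice of [U], [v] lies outside [Y + U]. A functional with value 1 at [v] that kills
    [Y + U] is continuous because it vanishes on the neighbourhood [U]. *)
Lemma separation Y v : closed [set` Y] -> v \notin Y ->
  exists2 chi : cont_dual V, ev chi v = 1 & forall y, y \in Y -> ev chi y = 0.
Proof.
move=> Yc vY; have [U U0 UY] := closed_submod_avoid Yc vY.
have [||H HP] := @submod_exists _ V (fun x => exists2 y, y \in Y & x - y \in U).
- by exists 0; rewrite ?subr0 ?rpred0.
- move=> a x1 x2 [y1 y1Y xy1] [y2 y2Y xy2]; exists (a *: y1 + y2).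
    by rewrite rpredD// rpredZ.
  by rewrite opprD addrACA -scalerBr rpredD// rpredZ.
have YH y : y \in Y -> y \in H by move=> yY; apply/HP; exists y; rewrite // subrr rpred0.
have UH u : u \in U -> u \in H by move=> uU; apply/HP; exists 0; rewrite ?rpred0// subr0.
have vH : v \notin H.
  apply/negP => /HP[y yY vyU]; have := UY (- (v - y)).
  by rewrite submodN// ?vyU opprB addrC subrK yY => /(_ isT).
have [f [fl fv fH]] := functional_extension vH.
have [|chi chif] := continuous_functional V_tvs fl U0; first by move=> u /UH/fH.
by exists chi => [|y /YH/fH]; rewrite /ev chif.
Qed.

End Functionals.

(** Each image set gets one preimage in [F]; a common point [s] of the finitely many chosen sets
    yields the common point [h s]. *)
Lemma finI_transfer (S T : Type) (F : set (set S)) (g : set S -> set T) (h : S -> T) :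
  (forall A s, F A -> A s -> g A (h s)) ->
  finI F id -> finI [set g A | A in F] id.
Proof.
move=> gh FI D DF.
have /boolp.choice[k kP] : forall B, exists A, B \in D -> F A /\ g A = B.
  move=> B; have [BD|_] := boolP (B \in D); last by exists set0.
  by have /set_mem[A FA <-] := DF B BD; exists A.
have [|s sk] := FI [fset k B | B in D]%fset.
  by move=> _ /imfsetP[B /= BD ->]; apply: mem_set; case: (kP B BD).
exists (h s) => B /= BD; have [FkB <-] := kP B BD.
by apply: gh => //; apply: (sk (k B)); apply/imfsetP; exists B.
Qed.

(** * Linear compactness of closed subspaces *)

Section Subspace.
Variables (K : fieldType) (V : topLmodType K) (U : submodClosed V).

Lemma nbhs_sub (x : sub_space U) (A : set (sub_space U)) :
  nbhs x A <-> exists2 B : set V, nbhs (val x) B & val @^-1` B `<=` A.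
Proof.
split=> [|[B xB BA]].
  rewrite nbhsE => -[_ [[B Bo <-] Bx] BA]; exists B => //.
  exact: open_nbhs_nbhs.
apply: filterS BA _.
exact: (@initial_continuous _ _ (val : sub_space U -> V) x B xB).
Qed.

Lemma linearly_topologized_sub :
  linearly_topologized V -> linearly_topologized (sub_space U).
Proof.
move=> [[Vadd Vscale] VH basis]; split; first split.
- move=> [x y] A /nbhs_sub[B /(Vadd (val x, val y))[[C D]] /= [xC yD] CD BA].
  exists (val @^-1` C, val @^-1` D) => /=.
    by split; apply/nbhs_sub; [exists C|exists D].
  by move=> [x' y'] /= [Cx Dy]; apply: BA; exact: (CD (_, _)).
- move=> [a y] A /nbhs_sub[B /(Vscale (a, val y))[[C D]] /= [aC yD] CD BA].
  exists (C, val @^-1` D) => /=; first by split => //; apply/nbhs_sub; exists D.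
  by move=> [a' y'] /= [Ca Dy]; apply: BA; exact: (CD (_, _)).
- move=> x y xy; apply: val_inj; apply: VH => A B xA yB.
  have [||z [Az Bz]] := xy (val @^-1` A) (val @^-1` B).
  + by apply/nbhs_sub; exists A.
  + by apply/nbhs_sub; exists B.
  by exists (val z).
- move=> A /nbhs_sub[B /basis[W [W0 WB]] BA].
  exists (trace_sub W : submodClosed (sub_space U)); split.
    by apply/nbhs_sub; exists [set` W].
  by move=> x xW; apply: BA; exact: WB.
Qed.

Lemma closed_val_image (A : set (sub_space U)) :
  closed [set` U] -> closed A -> closed [set val x | x in A].
Proof.
move=> Uc /closed_openC[B Bo BA].
rewrite (_ : image _ _ = [set` U] `&` ~` B).
  by apply: closedI => //; exact: open_closedC.
apply/seteqP; split=> [_ [x Ax <-]|x [/= xU xB]].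
  split; first exact: (valP x).
  by move=> Bx; have : (val @^-1` B) x by []; rewrite BA.
exists (exist _ x xU) => //; apply: contrapT => Ax.
by apply: xB; have : (~` A) (exist _ x xU) by []; rewrite -BA.
Qed.

Lemma linearly_compact_sub :
  closed [set` U] -> linearly_compact V -> linearly_compact (sub_space U).
Proof.
move=> Uc [Vlt Vc]; split=> [|F Fcl FI]; first exact: linearly_topologized_sub.
(* The common point is found in [V], and a member [A0] is what places it in [U]; an empty family is
   served by 0. *)
have [[A0 FA0]|F0] := pselect (F !=set0); last first.
  by exists 0 => A FA; case: F0; exists A.
have Fim A : F A -> closed [set val x | x in A] /\ linear_variety [set val x | x in A].
  move=> /Fcl[Acl [v [W AE]]]; split; first exact: closed_val_image.
  rewrite {}AE.
  have [||W' W'P] := @submod_exists _ V (fun y => exists2 w, w \in W & val w = y).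
  - by exists 0; rewrite ?rpred0.
  - move=> a _ _ [x xW <-] [y yW <-]; exists (a *: x + y) => //.
    by rewrite rpredD// rpredZ.
  exists (val v), W'; apply/seteqP; split=> [_ [_ [w wW <-] <-]|_ [_ /W'P[w wW <-] <-]].
    by exists (val w) => //; apply/W'P; exists w.
  by exists (v + w) => //; exists w.
have [||x xF] := Vc [set [set val x | x in A] | A in F].
- by move=> _ [A FA <-]; exact: Fim.
- by apply: (finI_transfer (h := val)) FI => A s _ As; exists s.
have [|x0 A0x0 x0x] := xF [set val x | x in A0]; first by exists A0.
exists x0 => A FA; have [|y Ay] := xF [set val x | x in A]; first by exists A.
by rewrite -x0x => /val_inj <-.
Qed.

End Subspace.

(** * Linear compactness of quotients by closed subspaces *)

Section Quotient.
Variables (K : fieldType) (V : topLmodType K) (Z : submodClosed V).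
Hypothesis V_tvs : topological_vector_space V.
Local Notation Q := (quot_space Z).
Local Notation pi := (quot_pi Z).

(** The projection is an open map: the saturation of an open set is a union of its translates. *)
Lemma nbhs_quot (x : V) (A : set Q) : nbhs (pi x) A <-> nbhs x (pi @^-1` A).
Proof.
split.
  rewrite !nbhsE => -[B [Bo Bx] BA]; exists (pi @^-1` B); last by move=> y /BA.
  by split.
rewrite nbhsE => -[B [Bo Bx] BA]; rewrite nbhsE; exists [set pi y | y in B].
  split; last by exists x.
  change (open (pi @^-1` [set pi y | y in B])); rewrite openE => y [b Bb /quot_piP byZ].
  have : nbhs (b - y + y) B by rewrite subrK; exact: open_nbhs_nbhs.
  move=> /(nbhs_translate V_tvs); apply: filterS => w Bw.
  by exists (b - y + w) => //; apply/quot_piP; rewrite addrK.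
by move=> _ [y /BA ? <-].
Qed.

Lemma closed_pi_preimage (A : set Q) : closed A -> closed (pi @^-1` A).
Proof. by rewrite -!openC. Qed.

Lemma linearly_topologized_quot : closed [set` Z] -> linearly_topologized V ->
  linearly_topologized Q.
Proof.
move=> Zc Vlt; have [[Vadd Vscale] _ basis] := Vlt.
have piP (q : Q) : exists x, pi x = q by exists (repr q); exact: quot_pi_repr.
split; first split.
- move=> [q1 q2] A; have [[x <-] [y <-]] := (piP q1, piP q2).
  rewrite /= -linearD => /nbhs_quot/(Vadd (x, y))[[C D]] /= [xC yD] CD.
  exists ([set pi z | z in C], [set pi z | z in D]) => /=.
    by split; apply/nbhs_quot; [apply: filterS xC|apply: filterS yD] => z ?; exists z.
  move=> [_ _] /= [[x' Cx' <-] [y' Dy' <-]]; rewrite /= -linearD.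
  exact: (CD (_, _)).
- move=> [a q] A; have [y <-] := piP q.
  rewrite /= -linearZ => /nbhs_quot/(Vscale (a, y))[[C D]] /= [aC yD] CD.
  exists (C, [set pi z | z in D]) => /=.
    by split=> //; apply/nbhs_quot; apply: filterS yD => z ?; exists z.
  move=> [a' _] /= [Ca' [y' Dy' <-]]; rewrite /= -linearZ.
  exact: (CD (_, _)).
- move=> p q; have [[x <-] [y <-]] := (piP p, piP q) => pq.
  apply/quot_piP; apply: contrapT => /negP xyZ.
  (* The images of [x + U] and [y + U] are disjoint: a common point would put [x - y + (u - w)] in
     [Z] for some [u] and [w] in [U]. *)
  have [U U0 UZ] := closed_submod_avoid Vlt Zc xyZ.
  have nb z : nbhs (pi z) [set pi (z + u) | u in [set` U]].
    apply/nbhs_quot/(nbhs_shift V_tvs); apply: filterS U0 => u uU /=.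
    by exists u.
  have [_ [[u uU <-] [w wU /quot_piP]]] := pq _ _ (nb x) (nb y).
  rewrite opprD addrACA => /submodN; rewrite opprD !opprB => wuZ.
  by have /negP := UZ (u - w) (submodB uU wU); apply.
- move=> A; rewrite -(linear0 pi) => /nbhs_quot/basis[W [W0 WA]].
  have [||W' W'P] := @submod_exists _ Q (fun q => exists2 w, w \in W & pi w = q).
  + by exists 0; rewrite ?rpred0 ?linear0.
  + move=> a _ _ [x xW <-] [y yW <-]; exists (a *: x + y); last by rewrite linearP.
    by rewrite rpredD// rpredZ.
  exists W'; split; last by move=> _ /W'P[w wW <-]; exact: WA.
  apply/nbhs_quot; apply: filterS W0 => w wW; apply/W'P.
  by exists w.
Qed.

(** Preimages of closed varieties are closed varieties of [V], and a common point of theirs projects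
    to one of the given family. *)
Lemma linearly_compact_quot : closed [set` Z] -> linearly_compact V ->
  linearly_compact Q.
Proof.
move=> Zc [Vlt Vc]; split=> [|F Fcl FI]; first exact: linearly_topologized_quot.
have Fpre A : F A -> closed (pi @^-1` A) /\ linear_variety (pi @^-1` A).
  move=> /Fcl[Acl [q [W AE]]]; split; first exact: closed_pi_preimage.
  have [||W' W'P] := @submod_exists _ V (fun y => pi y \in W).
  - by rewrite linear0 rpred0.
  - by move=> a x y xW yW; rewrite linearP rpredD// rpredZ.
  exists (repr q), W'; rewrite {}AE.
  apply/seteqP; split=> [x [w wW /= qw]|_ [w /W'P wW <-]] /=.
    exists (x - repr q); last by rewrite addrC subrK.
    by apply/W'P; rewrite linearB/= quot_pi_repr -qw addrAC subrr add0r.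
  by exists (pi w); rewrite // linearD/= quot_pi_repr.
have [||x xF] := Vc [set pi @^-1` A | A in F].
- by move=> _ [A FA <-]; exact: Fpre.
- apply: (finI_transfer (h := repr)) FI => A q _ Aq.
  by rewrite /preimage /= quot_pi_repr.
by exists (pi x) => A FA; apply: (xF (pi @^-1` A)); exists A.
Qed.

End Quotient.

(** * Linear dependence of functionals, and the dual flow *)

Lemma kernel_span (K : fieldType) (V : lmodType K) n (f : nat -> {linear V -> K^o})
    (g : {linear V -> K^o}) :
  (forall x, (forall i, (i < n)%N -> f i x = 0) -> g x = 0) ->
  exists c : nat -> K, forall x, g x = \sum_(i < n) c i * f i x.
Proof.
elim: n g => [|n IH] g gf; first by exists (fun=> 0) => x; rewrite big_ord0 gf.
(* If [f n] vanishes on the common kernel of the earlier functionals, it gets coefficient 0. *)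
have [fn|/existsNP[v /not_implyP[fv /eqP fnv]]] :=
    pselect (forall x, (forall i, (i < n)%N -> f i x = 0) -> f n x = 0).
  have [x fx|c cP] := IH g.
    by apply: gf => i; rewrite ltnS leq_eqVlt => /predU1P[->|]; [exact: fn|exact: fx].
  exists (fun i => if i == n then 0 else c i) => x.
  rewrite cP big_ord_recr/= eqxx mul0r addr0.
  by apply: eq_bigr => i _; rewrite ltn_eqF.
(* With this [b], [g - b f_n] vanishes at [v], hence on the whole common kernel of the earlier
   functionals, where [v] spans a complement of the kernel of [f n]. *)
pose b : K := g v / f n v.
have [x fx|c cP] := IH (g \- b \*: f n).
  have : g (x - (f n x / f n v) *: v) = 0.
    apply: gf => i; rewrite ltnS leq_eqVlt linearB linearZ/= => /predU1P[->|ni].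
      by rewrite -[_ *: _]/(_ * _) divfK// subrr.
    by rewrite (fx i ni) (fv i ni) scaler0 subr0.
  rewrite linearB linearZ/= => /eqP; rewrite subr_eq0 => /eqP gx.
  change (g x - b * f n x = 0); apply/eqP; rewrite subr_eq0 gx; apply/eqP.
  change (f n x / f n v * g v = b * f n x).
  by rewrite mulrAC -mulrA mulrC.
exists (fun i => if i == n then b else c i) => x.
rewrite big_ord_recr/= eqxx; apply/eqP; rewrite -subr_eq; apply/eqP.
change ((g \- b \*: f n) x = \sum_(i < n) (if i == n :> nat then b else c i) * f i x).
rewrite cP; by apply: eq_bigr => i _; rewrite ltn_eqF.
Qed.

Section DualFlow.
Variables (K : fieldType) (V : topLmodType K) (phi : {linear V -> V}).
Hypothesis phi_cont : continuous phi.
Local Notation dphi := (dual_map phi_cont).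
Implicit Types (chi : cont_dual V).

Lemma ev_iter n chi x : ev (iter n dphi chi) x = ev chi (iter n phi x).
Proof. by elim: n x => // n IH x; rewrite [in RHS]iterSr -IH. Qed.

Lemma ev_poly_act p chi x :
  ev (poly_act dphi p chi) x = \sum_(i < size p) p`_i * ev chi (iter i phi x).
Proof. by rewrite ev_sum; apply: eq_bigr => i _; rewrite ev_iter. Qed.

Lemma dual_basis_not_torsion chi : ~ torsion dphi chi ->
  forall n, exists v : 'I_n -> V,
    forall i j : 'I_n, ev chi (iter i phi (v j)) = (i == j)%:R.
Proof.
move=> chit n.
suff /boolp.choice[v vP] : forall j : 'I_n, exists v, forall i : 'I_n,
    ev chi (iter i phi v) = (i == j)%:R by exists v => i j; exact: vP.
(* Replacing functional [j] by 0 keeps the index set and imposes no condition. *)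
move=> j; pose f i : {linear V -> K^o} :=
  ev (if i == j :> nat then 0 else iter i dphi chi).
have [ker|/existsNP[v /not_implyP[fv /eqP jv]]] :=
    pselect (forall x, (forall i, (i < n)%N -> f i x = 0) -> ev (iter j dphi chi) x = 0).
  have [c cP] := kernel_span ker.
  (* The relation expressing iterate [j] through the others; its entry [j] is 1. *)
  pose d := \row_(i < n) ((i == j)%:R - (if i == j then 0 else c i)).
  have d0 : d = 0.
    apply: (not_torsion_free chit); apply: dual_ext => x; rewrite ev_sum ev0.
    under eq_bigr do rewrite mxE mulrBl.
    rewrite big_split/= sumrN [X in X - _](_ : _ = ev (iter j dphi chi) x).
      rewrite cP -sumrB big1// => i _; rewrite /f -val_eqE/=.
      by case: eqP => _; rewrite ?ev0 ?mul0r ?mulr0 subrr.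
    rewrite (bigD1 j)//= eqxx mul1r big1 ?addr0// => i /negbTE ->.
    by rewrite mul0r.
  by have /rowP/(_ j)/eqP := d0; rewrite !mxE eqxx subr0 oner_eq0.
exists ((ev (iter j dphi chi) v)^-1 *: v) => i; rewrite -ev_iter linearZ/=.
rewrite -[_ *: _]/(_ * _); have [->|ij] := eqVneq i j; first by rewrite mulVf.
have := fv i (ltn_ord i); rewrite /f val_eqE (negbTE ij) => ->.
by rewrite mulr0.
Qed.

End DualFlow.

(** * Topological entropy of factors, read off the dual flow *)

Section TopologicalEntropy.
Variables (R : realType) (K : fieldType) (V : topLmodType K).
Variable phi : {linear V -> V}.
Hypotheses (V_lc : linearly_compact V) (phi_cont : continuous phi).
Local Notation dphi := (dual_map phi_cont).
Implicit Types (chi : cont_dual V) (Y : submodClosed V).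

Let V_tvs : topological_vector_space V. Proof. by case: V_lc => -[]. Qed.

Lemma iter_induced Y (phiY : invariant_sub phi Y) n x :
  iter n (induced_map phiY) (quot_pi Y x) = quot_pi Y (iter n phi x).
Proof. by elim: n => //= n ->; rewrite induced_pi. Qed.

(** Each iterate of [chi] is a combination of the first [N], [N] being the size of an annihilator. A
    vector killed by these lies in [Y], so the factor has dimension at most [N]. *)
Lemma ent_top_torsion chi Y (phiY : invariant_sub phi Y) : closed [set` Y] ->
  torsion dphi chi -> (forall x, (forall n, ev chi (iter n phi x) = 0) -> x \in Y) ->
  ent_top R (induced_map phiY) = 0%E.
Proof.
move=> Yc [p p0 pchi] chiY.
have Q_lc := linearly_compact_quot V_tvs Yc V_lc.
pose N := size p.
have lim0 (U : submodClosed (quot_space Y)) :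
    lim ((fun n => (n%:R^-1)%:E * dim_quot R U (cotraj (induced_map phiY) U n))%E
           @ \oo) = 0%E.
  rewrite (lim_average (c := 0) (N := N))// => n _.
  have [|m mN ->] := @dim_quot_le R K _ U (cotraj (induced_map phiY) U n) N.
    move=> a aU.
    have [c c0 cA] := short_matrix_kernel
      (\matrix_(j < N.+1, i < N) (ev chi (iter i phi (repr (a j))) : K)) (ltnSn _).
    exists c => //; rewrite (_ : \sum_i _ = 0) ?rpred0//.
    under eq_bigr do rewrite -[a _]quot_pi_repr.
    rewrite -quot_pi_lincomb; apply/quot_pi_eq0/chiY => k.
    rewrite -ev_iter (iter_annihilated k p0 pchi) (@poly_act_widen _ _ _ N).
      rewrite ev_sum big1// => i _; rewrite ev_iter.
      have /rowP/(_ i) := cA; rewrite !mxE => cAi.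
      rewrite -(ev_iter phi_cont) linear_sum/=.
      rewrite (_ : \sum_j _ = 0) ?mulr0// -[RHS]cAi; apply: eq_bigr => j _.
      by rewrite linearZ/= mxE ev_iter.
    by rewrite ltnW// ltn_modp.
  by exists m; rewrite muln0.
rewrite /ent_top (_ : image _ _ = [set 0%E]) ?ereal_sup1//.
apply/seteqP; split=> [_ [U _ <-]|_ ->]; first exact: lim0.
(* The whole factor is an admissible [U], so the supremum ranges over a non-empty set. *)
have [//|//|U UP] := @submod_exists _ (quot_space Y) (fun=> True).
have UT : [set` U] = setT by apply/seteqP; split=> // q _; exact/UP.
exists U; last exact: lim0.
split; first by rewrite UT; exact: openT.
by apply: linearly_compact_sub => //; rewrite UT; exact: closedT.
Qed.

(** [U] is the kernel of the functional induced by [chi] on the factor. On [U], the first of the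
    [n.+1] conditions defining the cotrajectory is automatic and the other [n] are independent, so
    the averages tend to 1. *)
Lemma ent_top_not_torsion chi Y (phiY : invariant_sub phi Y) : closed [set` Y] ->
  ~ torsion dphi chi -> (forall y, y \in Y -> ev chi y = 0) ->
  ent_top R (induced_map phiY) != 0%E.
Proof.
move=> Yc chit chiY.
have Q_lc := linearly_compact_quot V_tvs Yc V_lc.
have chi_repr x : ev chi (repr (quot_pi Y x)) = ev chi x.
  apply/eqP; rewrite -subr_eq0 -linearB; apply/eqP/chiY/quot_piP.
  by rewrite quot_pi_repr.
have [||U UP] := @submod_exists _ (quot_space Y) (fun q => ev chi (repr q) = 0).
- by rewrite -(linear0 (quot_pi Y)) chi_repr linear0.
- move=> a q1 q2 q10 q20; rewrite -[q1]quot_pi_repr -[q2]quot_pi_repr.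
  by rewrite -linearP chi_repr linearP/= q10 q20 scaler0 addr0.
have piU x : quot_pi Y x \in U <-> ev chi x = 0 by rewrite UP chi_repr.
have U0 : nbhs 0 [set` U].
  rewrite -(linear0 (quot_pi Y)); apply/(nbhs_quot V_tvs).
  apply: filterS (near_ev chi 0) => x; rewrite linear0 => x0.
  exact/piU.
have Q_tvs : topological_vector_space (quot_space Y) by case: Q_lc => -[].
have U_lc : linearly_compact (sub_space U).
  by apply: linearly_compact_sub => //; exact: closed_submod.
have cotrajP x n : quot_pi Y x \in cotraj (induced_map phiY) U n <->
    forall i : 'I_n, ev chi (iter i phi x) = 0.
  split=> [/forallP xU i|xU]; last apply/forallP => i.
    by apply/piU; rewrite -(iter_induced phiY).
  by rewrite iter_induced; apply/piU.
have lim1 : lim ((fun n =>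
    (n%:R^-1)%:E * dim_quot R U (cotraj (induced_map phiY) U n))%E @ \oo) = 1%E.
  rewrite (lim_average (c := 1) (N := 1))// => -[//|n] _; exists n.
  rewrite muln1 !addn1 leqnn leqW//; split=> //.
  have [v vP] := dual_basis_not_torsion chit n.+1.
  (* Dropping index 0 puts the classes of these vectors in [U]; [w i] is dual to iterate [i.+1] of
     [chi]. *)
  pose w (i : 'I_n) := v (lift ord0 i).
  have chiw (c : 'I_n -> K) k :
      ev chi (iter k phi (\sum_i c i *: w i)) = \sum_i c i * ev chi (iter k phi (w i)).
    by rewrite -(ev_iter phi_cont) linear_sum; apply: eq_bigr => i _;
      rewrite linearZ/= ev_iter.
  have chiw0 (c : 'I_n -> K) : ev chi (\sum_i c i *: w i) = 0.
    by rewrite -[X in ev _ X]/(iter 0 phi _) chiw big1// => i _; rewrite (vP ord0) mulr0.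
  have chiwS (c : 'I_n -> K) (k : 'I_n) :
      ev chi (iter k.+1 phi (\sum_i c i *: w i)) = c k.
    rewrite chiw (bigD1 k)//= big1 ?addr0 => [|i ik].
      by rewrite -iterS (vP (lift ord0 k)) eqxx mulr1.
    rewrite -iterS (vP (lift ord0 k)) (inj_eq (@lift_inj _ ord0)).
    by rewrite eq_sym (negbTE ik) mulr0.
  apply: (dim_quot_eq R (b := fun i => quot_pi Y (w i))) => [i|a|c].
  - by apply/piU; exact: (vP ord0).
  - rewrite -[a]quot_pi_repr => /piU a0.
    pose c := \row_(i < n) (ev chi (iter i.+1 phi (repr a)) : K); exists c.
    rewrite -quot_pi_lincomb -linearB; apply/cotrajP => i.
    rewrite -(ev_iter phi_cont) linearB/= !ev_iter.
    case: (unliftP ord0 i) => [j ->|->]; last by rewrite chiw0 a0 subrr.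
    by rewrite -[nat_of_ord _]/(j.+1) chiwS mxE subrr.
  - rewrite -quot_pi_lincomb => /cotrajP c0; apply/rowP => k.
    by rewrite mxE -(chiwS (c 0) k) (c0 (lift ord0 k)).
rewrite gt_eqF//; apply: (@lt_le_trans _ _ 1%E); first exact: lte01.
by apply: ereal_sup_ubound; exists U => //; split=> //; exact: open_submod.
Qed.

Lemma cp_ent_topP :
  cp_ent_top R phi <-> forall chi, torsion dphi chi -> chi = 0.
Proof.
split=> [Vcp chi chit|Vt Z phiZ Zc [x xZ]].
  (* The largest invariant subspace inside the kernel of [chi]; its factor has zero entropy, so it
     cannot be proper. *)
  have [||Y YP] := @submod_exists _ V (fun x => forall n, ev chi (iter n phi x) = 0).
  - by move=> n; rewrite -(ev_iter phi_cont) linear0.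
  - move=> a x y x0 y0 n.
    by rewrite -(ev_iter phi_cont) linearP/= !ev_iter x0 y0 scaler0 addr0.
  have phiY : invariant_sub phi Y.
    by move=> x /YP x0; apply/YP => n; rewrite -iterSr.
  have Yc : closed [set` Y].
    rewrite (_ : [set` Y] = [set x | forall n, ev (iter n dphi chi) x = 0]).
      exact: closed_forall_ev.
    by apply/seteqP; split=> [x /YP x0 n|x x0]; [|apply/YP => n];
      rewrite ?ev_iter// -(ev_iter phi_cont).
  have YT x : x \in Y.
    apply: contrapT => /negP xY; have /eqP := Vcp Y phiY Yc (ex_intro _ x xY).
    by apply; apply: (ent_top_torsion (chi := chi)) => // y /YP.
  by apply: dual_ext => x; have /YP/(_ 0%N) := YT x.
have [chi chix chiZ] := separation V_lc.1 Zc xZ.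
apply: (ent_top_not_torsion (chi := chi)) => // /Vt chi0.
by move: chix; rewrite chi0 ev0 => /eqP; rewrite eq_sym oner_eq0.
Qed.

End TopologicalEntropy.

(** * Double annihilators and restriction of functionals *)

Section Annihilators.
Variables (K : fieldType) (V : topLmodType K).
Hypothesis V_lc : linearly_compact V.
Implicit Types (P : submodClosed (cont_dual V)) (U : submodClosed V).

Let V_tvs : topological_vector_space V. Proof. by case: V_lc => -[]. Qed.

Lemma mem_perp P x : x \in perp P <-> forall chi, chi \in P -> ev chi x = 0.
Proof. by split=> [/asboolP|xP]; [|apply/asboolP]. Qed.

Lemma closed_perp P : closed [set` perp P].
Proof.
rewrite (_ : [set` perp P] =
    [set x | forall chi : {chi | chi \in P}, ev (sval chi) x = 0]).
  exact: closed_forall_ev.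
apply/seteqP; split=> [x /mem_perp xP [chi chiP]|x xP]; first exact: xP.
by apply/mem_perp => chi chiP; exact: (xP (exist _ chi chiP)).
Qed.

(* The closed varieties {eta = 1} and ker chi (chi in P) have no common point, so
   by linear compactness finitely many ker chi intersect inside ker eta, and eta
   is a linear combination of the corresponding chi. *)
Lemma perp_perp P eta : (forall x, x \in perp P -> ev eta x = 0) -> eta \in P.
Proof.
move=> etaP; apply: contrapT => /negP etaNP.
have [v0 v0eta] : exists v, ev eta v != 0.
  apply: contrapT => /forallNP eta0; case/negP: etaNP.
  rewrite (_ : eta = 0) ?rpred0//; apply: dual_ext => x.
  by apply/eqP/negPn/negP; exact: eta0.
pose v : V := (ev eta v0 : K)^-1 *: v0.
have etav : ev eta v = 1 by rewrite linearZ; exact: mulVf.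
pose ker (chi : cont_dual V) := [set x | ev chi x = 0].
pose F : set (set V) := [set [set x | ev eta x = 1]] `|` [set ker chi | chi in [set` P]].
have kerP (chi : cont_dual V) :
    exists W : submodClosed V, forall x, x \in W <-> ev chi x = 0.
  apply: submod_exists => [|a x y x0 y0]; first exact: linear0.
  by rewrite linearP/= x0 y0 scaler0 addr0.
have FV A : F A -> closed A /\ linear_variety A.
  case=> [->|[chi chiP <-]]; (split; first exact: closed_ev).
    have [W WP] := kerP eta; exists v, W.
    apply/seteqP; split=> [x /= x1|_ [w /WP w0 <-]] /=; last first.
      by rewrite linearD/= etav w0 addr0.
    exists (x - v); last by rewrite addrC subrK.
    by apply/WP; rewrite linearB/= x1 etav subrr.
  have [W WP] := kerP chi; exists 0, W.
  apply/seteqP; split=> [x x0|_ [w /WP w0 <-]]; last by rewrite add0r.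
  by exists x; rewrite ?add0r//; apply/WP.
have : ~ finI F id.
  move=> /(V_lc.2 F FV)[x xF].
  have : ev eta x = 1 by apply: (xF [set x | ev eta x = 1]); left.
  rewrite etaP => [/eqP|]; first by rewrite eq_sym oner_eq0.
  by apply/mem_perp => chi chiP; apply: (xF (ker chi)); right; exists chi.
move=> /existsNP[D /not_implyP[DF D0]]; case/negP: etaNP.
(* Each kernel in [D] gets a functional of [P] defining it; the variety where [eta] is 1 needs none,
   and 0 will do. *)
have /boolp.choice[k kP] : forall A, exists chi : cont_dual V,
    chi \in P /\ (A \in D -> A = [set x | ev eta x = 1] \/ A = ker chi).
  move=> A; have [/DF/set_mem[->|[chi chiP <-]]|_] := boolP (A \in D).
  - by exists 0; split; [exact: rpred0|left].
  - by exists chi; split=> // _; right.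
  - by exists 0; split; first exact: rpred0.
pose s : seq (set V) := D; pose f i := k (nth setT s i).
have [x fx|c cP] := @kernel_span K V (size s)
  (fun i => ev (f i) : {linear V -> K^o}) (ev eta).
  apply: contrapT => /eqP etax; apply: D0.
  (* Rescaled to have value 1 under [eta], [x] would be a common point of [D]. *)
  exists ((ev eta x : K)^-1 *: x) => A /= AD.
  have [_ /(_ AD)[->|->]] := kP A; first by rewrite /= linearZ; exact: mulVf.
  have As : A \in s by [].
  have := fx (index A s); rewrite index_mem => /(_ As).
  by rewrite /f nth_index// /ker /= linearZ/= => ->; rewrite scaler0.
have -> : eta = \sum_(i < size s) c i *: f i.
  by apply: dual_ext => x; rewrite ev_sum cP.
by apply: rpred_sum => i _; apply: rpredZ; case: (kP (nth setT s i)).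
Qed.

Lemma dual_restr_subproof U (chi : cont_dual V) :
  (val chi \o val : sub_space U -> K^o) \in @cont_dual_pred K (sub_space U).
Proof.
apply/asboolP; split=> [a x y|]; first exact: (dual_linear chi).
apply/continuous_discreteP => x; apply/nbhs_sub.
by exists [set y | ev chi y = ev chi (val x)] => //; exact: near_ev.
Qed.

Definition dual_restr U (chi : cont_dual V) : cont_dual (sub_space U) :=
  exist _ (val chi \o val : sub_space U -> K^o) (dual_restr_subproof U chi).

Lemma ev_dual_restr U chi x : ev (dual_restr U chi) x = ev chi (val x).
Proof. by []. Qed.

(** The kernel of [chi] is closed in [V] because [U] is. If [chi v] is 1, [separation] gives an
    [eta] that kills this kernel and is 1 at [v]; kernel and [v] together span [U]. *)
Lemma dual_restr_surj U (chi : cont_dual (sub_space U)) : closed [set` U] ->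
  exists eta, dual_restr U eta = chi.
Proof.
move=> Uc; have [[x0 chix0]|chi0] := pselect (exists x, ev chi x <> 0); last first.
  exists 0; apply: dual_ext => x; rewrite ev_dual_restr ev0.
  by apply: contrapT => chix; apply: chi0; exists x; exact: nesym.
pose v : sub_space U := (ev chi x0 : K)^-1 *: x0.
have chiv : ev chi v = 1 by rewrite linearZ; apply: mulVf; exact/eqP.
have [||N NP] := @submod_exists _ V (fun y => exists2 x, ev chi x = 0 & val x = y).
- by exists 0; rewrite ?linear0.
- move=> a _ _ [x x1 <-] [y y1 <-]; exists (a *: x + y) => //.
  by rewrite linearP/= x1 y1 scaler0 addr0.
have Nc : closed [set` N].
  rewrite (_ : [set` N] = [set val x | x in [set x | ev chi x = 0]]).
    by apply: closed_val_image => //; exact: closed_ev.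
  by apply/seteqP; split=> y; move/NP.
have vN : val v \notin N.
  apply/negP => /NP[x x0' /val_inj xv]; move/eqP: chiv.
  by rewrite -xv x0' eq_sym oner_eq0.
have [eta etav etaN] := separation V_lc.1 Nc vN.
exists eta; apply: dual_ext => x; rewrite ev_dual_restr.
have /etaN : val (x - (ev chi x : K) *: v) \in N.
  apply/NP; exists (x - (ev chi x : K) *: v) => //.
  by rewrite linearB linearZ/= chiv [_ *: _]mulr1 subrr.
rewrite -[val _]/(val x - (ev chi x : K) *: val v) linearB linearZ/= etav.
by move/eqP; rewrite subr_eq0 => /eqP ->; exact: mulr1.
Qed.

Variable phi : {linear V -> V}.
Hypothesis phi_cont : continuous phi.

Lemma restr_continuous U (phiU : invariant_sub phi U) : continuous (restr_map phiU).
Proof.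
move=> x A /nbhs_sub[B xB BA]; apply/nbhs_sub; exists (phi @^-1` B).
  exact: (phi_cont xB).
by move=> y By; apply: BA.
Qed.

Lemma poly_act_dual_restr U (phiU : invariant_sub phi U) p eta :
  poly_act (dual_map (@restr_continuous U phiU)) p (dual_restr U eta) =
  dual_restr U (poly_act (dual_map phi_cont) p eta).
Proof.
apply: dual_ext => x; rewrite ev_dual_restr !ev_poly_act.
by apply: eq_bigr => i _; rewrite ev_dual_restr iter_restr.
Qed.

End Annihilators.

Arguments restr_continuous {K V phi} phi_cont {U} phiU _ _ _.

(** Proof irrelevance turns equal membership into equality, along which the dependent types
    [quot_space U] and [sub_space U] can be rewritten. *)
Lemma submod_eq (K : fieldType) (V : lmodType K) (U1 U2 : submodClosed V) :
  U1 =i U2 -> U1 = U2.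
Proof.
case: U1 U2 => [s1 [[m1] [n1]]] [s2 [[m2] [n2]]] E.
have s12 : s1 = s2 by apply: funext => x; exact: E.
move: m2 n2 {E}; case: _ / s12 => m2 n2.
by rewrite (Prop_irrelevance m1 m2) (Prop_irrelevance n1 n2).
Qed.

Lemma flow_top_iso_quot (K : fieldType) (V : topLmodType K) (phi : {linear V -> V})
    (U1 U2 : submodClosed V) (phi1 : invariant_sub phi U1) (phi2 : invariant_sub phi U2) :
  U1 =i U2 -> flow_top_iso (induced_map phi1) (induced_map phi2).
Proof.
move=> /submod_eq E; case: _ / E in phi2 *.
by rewrite (Prop_irrelevance phi2 phi1); exists idfun, id; split=> // x A.
Qed.

Lemma top_iso_sub (K : fieldType) (V : topLmodType K) (U1 U2 : submodClosed V) :
  U1 =i U2 -> top_iso (sub_space U1) (sub_space U2).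
Proof. by move=> /submod_eq ->; exists idfun, id; split=> // x A. Qed.

(** * Identification of [Dplus] with the annihilator of the Pinsker subspace *)

Section Bridge.
Variables (R : realType) (K : fieldType) (V : topLmodType K) (phi : {linear V -> V}).
Hypotheses (V_lc : linearly_compact V) (phi_cont : continuous phi).
Local Notation dphi := (dual_map phi_cont).
Local Notation P := (Palg R dphi).

Lemma cp_ent_top_perp_Palg (D : submodClosed V) (phiD : invariant_sub phi D) :
  D =i perp P -> cp_ent_top R (restr_map phiD).
Proof.
move=> DP.
have Dc : closed [set` D].
  by rewrite (submod_eq DP); exact: closed_perp.
apply/(cp_ent_topP R (linearly_compact_sub Dc V_lc) (restr_continuous phi_cont phiD)).
move=> chi [p p0 pchi]; have [eta etachi] := dual_restr_surj V_lc chi Dc.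
suff etaP : eta \in P.
  apply: dual_ext => x; rewrite -etachi ev_dual_restr ev0.
  by have := valP x; rewrite DP => /mem_perp; exact.
(* Read backwards: [p] applied to [eta] vanishes on [D], hence lies in [P] and is torsion, hence
   [eta] is torsion. *)
apply/mem_Palg/(torsion_poly_act p0)/(mem_Palg R)/(perp_perp V_lc) => x; rewrite -DP => xD.
rewrite -[x]/(val (exist _ x xD : sub_space D)) -ev_dual_restr.
by rewrite -(poly_act_dual_restr phi_cont phiD) etachi pchi ev0.
Qed.

Lemma mem_Dplus : Dplus R phi =i perp P.
Proof.
apply: (largest_uniq (D := perp P : submodClosed V)); split.
  split; first exact: closed_perp.
  exists (perp_invariant (Palg_invariant R dphi)).
  exact: cp_ent_top_perp_Palg.
move=> Z [Zc [phiZ]].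
move=> /(cp_ent_topP R (linearly_compact_sub Zc V_lc)
           (restr_continuous phi_cont phiZ)) Zt.
move=> z zZ; apply/mem_perp => chi /mem_Palg[p p0 pchi].
change (ev (dual_restr Z chi) (exist _ z zZ : sub_space Z) = 0).
rewrite (Zt (dual_restr Z chi)) ?ev0//.
exists p; rewrite // (poly_act_dual_restr phi_cont phiZ) pchi.
exact: dual_ext.
Qed.

(** A functional on [D] goes to the class of an extension to [V]. Two extensions differ by a
    functional vanishing on [D], which is in [P] by [perp_perp]; hence linearity, with restriction
    as inverse. *)
Lemma dual_Dplus : lin_iso (cont_dual (sub_space (Dplus R phi))) (Fplus R dphi).
Proof.
pose D := Dplus R phi.
have Dc : closed [set` D].
  by rewrite /D (submod_eq mem_Dplus); exact: closed_perp.
have /boolp.choice[ext extP] : forall chi, exists eta, dual_restr D eta = chi.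
  by move=> chi; exact: dual_restr_surj.
have piP eta1 eta2 : quot_pi P eta1 = quot_pi P eta2 <->
    forall x : sub_space D, ev eta1 (val x) = ev eta2 (val x).
  rewrite quot_piP; split=> [etaP x|eta12].
    apply/eqP; rewrite -subr_eq0; apply/eqP.
    by have := valP x; rewrite mem_Dplus => /mem_perp/(_ _ etaP).
  apply: (perp_perp V_lc) => x; rewrite -mem_Dplus => xD.
  apply/eqP; rewrite -[ev _ x]/(ev eta1 x - ev eta2 x) subr_eq0; apply/eqP.
  exact: (eta12 (exist _ x xD)).
have ev_ext chi x : ev (ext chi) (val x) = ev chi x by rewrite -ev_dual_restr extP.
pose f chi : Fplus R dphi := quot_pi P (ext chi).
have f_lin : linear f.
  move=> a chi1 chi2; rewrite /f -(linearP (quot_pi P)); apply/piP => x.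
  by rewrite ev_lin !ev_ext.
pose f_mixin := GRing.isLinear.Build K _ _ _ f f_lin.
pose F : {linear cont_dual (sub_space D) -> Fplus R dphi} := HB.pack f f_mixin.
exists F, (fun q => dual_restr D (repr q)) => [chi|q].
  apply: dual_ext => x; rewrite ev_dual_restr -ev_ext; apply: (piP _ _).1.
  by rewrite quot_pi_repr.
by rewrite -[RHS]quot_pi_repr; apply/piP => x; rewrite ev_ext.
Qed.

End Bridge.

Theorem theoremB (R : realType) (K : fieldType) (V : topLmodType K)
    (phi : {linear V -> V})
    (V_lc : linearly_compact V) (phi_cont : continuous phi) :
  [/\ flow_top_iso (Ptop_map R phi)
        (induced_map (perp_invariant (Palg_invariant R (dual_map phi_cont)))),
      top_iso (sub_space (Dplus R phi))
        (sub_space (perp (Palg R (dual_map phi_cont)))),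
      lin_iso (cont_dual (sub_space (Dplus R phi))) (Fplus R (dual_map phi_cont)) &
      cp_ent_top R phi <-> cp_ent_alg R (dual_map phi_cont)].
Proof.
have DP := mem_Dplus R V_lc phi_cont.
split; first exact: flow_top_iso_quot.
- exact: top_iso_sub.
- exact: dual_Dplus.
- by rewrite (cp_ent_topP R V_lc phi_cont) cp_ent_algP.
Qed.
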